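(* Let $V$ be a $\mathbb{Z}^n$-graded vector space. The $\mathbb{Z}^{n+1}$-graded stem bracket on $M_r(V)$ explicitly reads $$[A,B]^{\otimes}=j_AB-(-1)^{\langle(A,a),(B,b)\rangle}j_BA,$$ where $$(j_BA)(v_1\otimes\ldots\otimes v_{a+b+1})=(-1)^{\langle A,B\rangle}\sum_{\substack{I\cup J\cup K=N^{(a+b+1)}\\ I,J<K,\,|J|=b}}(-1)^{\langle B,V_I\rangle+b|I|}(-1)^{(I;J)}\varepsilon_V(I;J)\,A(V_I\otimes B(V_J\otimes v_{k_1})\otimes V_{K\setminus k_1}),$$ for any $A\in M^{(A,a)}(V)$, $B\in M^{(B,b)}(V)$, $a,b\ge0$, and $v_\ell\in V^{v_\ell}$.
   Context: Vector spaces are over a field $\mathbb{K}$ of characteristic $0$; for $\alpha,\beta\in\mathbb{Z}^m$, $\langle\alpha,\beta\rangle=\sum_i\alpha_i\beta_i$; thus $\langle(A,a),(B,b)\rangle=\langle A,B\rangle+ab$. A homogeneous vector or map and its degree/weight are denoted by the same symbol; $e_1=(1,0,\ldots,0)\in\mathbb{Z}^n$. $M^{(A,a)}(V)$, $a\ge0$, is the space of $(a+1)$-linear maps $V^{\times(a+1)}\to V$ of weight $A\in\mathbb{Z}^n$, and $M_r(V)=\bigoplus_{A\in\mathbb{Z}^n,\,a\ge0}M^{(A,a)}(V)$. Unshuffles. $N^{(p)}=(1,\ldots,p)$; an unshuffle is a naturally ordered (possibly empty) subset. In sums the unshuffles are pairwise disjoint with the given union; $K=(k_1<k_2<\ldots)$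 is nonempty, and $I<K$ means that the last element of $I$ is smaller than $k_1$ (vacuous for $I=\emptyset$). $V_I=v_{i_1}\otimes\ldots\otimes v_{i_{|I|}}$ (in exponents: its total degree). $(-1)^{(I;J)}$ is the signature of the permutation $(I;J)\to I\cup J$ (rearranging the concatenation $(I;J)$ into increasing order), and $\varepsilon_V(I;J)$ is the corresponding Koszul sign for the vectors $v_\ell$. Tensor coalgebra. For a graded space $W$, $T(W)=\bigoplus_{p\ge1}W^{\otimes p}$, $\mathbb{Z}^n$-graded by total degree, with coproduct $\Delta(w_1\otimes\ldots\otimes w_p)=\sum_{I\cup J=N^{(p-1)},\,I\ne\emptyset}\varepsilon_W(I;J)W_I\bigotimes W_J\otimes w_p$. Tensor products of maps: $(f\otimes g)(v_1\otimes v_2)=(-1)^{\langle g,v_1\rangle}f(v_1)\otimes g(v_2)$. A weight $Q$ coderivation is a weight $Q$ linear map with $\Delta Q=(Q\otimes\mathrm{id}+\mathrm{id}\otimes Q)\Delta$. The graded commutator is $[Q,Q']=QQ'-(-1)^{\langle Q,Q'\rangle}Q'Q$. A weight $Q$ coderivation is uniquely determined by its corestrictions $Q_p:W^{\otimes p}\hookrightarrow T(W)\xrightarrow{Q}T(W)\to W$, which can be arbitrary weight $Q$ maps, via $$Q(w_1\otimes\ldots\otimes w_p)=\sum_{I\cup J\cup K=N^{(p)},\;I,J<K}\varepsilon_W(I;J)(-1)^{\langle Q,W_I\rangle}W_I\otimes Q_{|J|+1}(W_J\otimes w_{k_1})\otimes W_{K\setminus k_1}.$$ $\mathrm{CoDer}^Q_p(T(W))$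 denotes the weight $Q$ coderivations all of whose corestrictions vanish except possibly $Q_p$. Desuspension. $\downarrow V$ is $V$ with grading $(\downarrow V)^\alpha=V^{\alpha+e_1}$; $\downarrow:V\to\downarrow V$ has weight $-e_1$ and inverse $\uparrow$ of weight $e_1$; $\uparrow^{\otimes p}=\uparrow\otimes\ldots\otimes\uparrow$ with the sign convention $(f\otimes g)(v_1\otimes v_2)=(-1)^{\langle g,v_1\rangle}f(v_1)\otimes g(v_2)$ for tensor products of maps. The isomorphism $\phi_{(A,a)}:M^{(A,a)}(V)\to\mathrm{CoDer}^{A+ae_1}_{a+1}(T(\downarrow V))$ sends $A$ to the coderivation whose only (possibly) nonzero corestriction is $(-1)^{\frac{a(a+1)}{2}}\downarrow\circ A\circ\uparrow^{\otimes(a+1)}$. The $\mathbb{Z}^{n+1}$-graded stem bracket on $M_r(V)$ is defined by $[A,B]^\otimes:=(-1)^{1+\langle ae_1,be_1+B\rangle}\phi^{-1}_{(A+B,a+b)}([\phi_{(A,a)}(A),\phi_{(B,b)}(B)])$ for $A\in M^{(A,a)}(V)$, $B\in M^{(B,b)}(V)$. *)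

(* Defs.v *)
From HB Require Import structures.
From mathcomp Require Import all_boot all_order all_algebra.
From mathcomp Require Import generic_quotient ring_quotient.
From mathcomp Require Import boolp classical_sets.
From mathcomp Require Import monalg.

Set Implicit Arguments.
Unset Strict Implicit.
Unset Printing Implicit Defensive.

Import GRing.Theory.
Local Open Scope quotient_scope.
Local Open Scope classical_set_scope.
Local Open Scope ring_scope.

Section Span.
Variables (K : fieldType) (L : lmodType K).

Definition is_subspace (S : set L) : Prop :=
  S 0 /\ forall (c : K) (x y : L), S x -> S y -> S (c *: x + y).

Definition lin_span (R : set L) : set L :=
  [set x | forall S : set L, is_subspace S -> R `<=` S -> S x].

Lemma lin_span_subspace (R : set L) : is_subspace (lin_span R).
Proof.
split=> [S [S0 _] _ //|c x y Hx Hy S SS RS].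
by case: (SS) => _; apply; [exact: Hx|exact: Hy].
Qed.

Definition span_pred (R : set L) : {pred L} := fun x => `[< lin_span R x >].

Lemma span_pred_zmod (R : set L) : zmod_closed (span_pred R).
Proof.
have [S0 SL] := lin_span_subspace R; split=> [|x y /asboolP Hx /asboolP Hy].
  exact/asboolP.
by apply/asboolP; rewrite addrC -scaleN1r; exact: SL.
Qed.

HB.instance Definition _ (R : set L) :=
  GRing.isZmodClosed.Build L (span_pred R) (span_pred_zmod R).

End Span.

(** [presented R] is the quotient of the free module [{malg K[X]}] on the set
    [X] by the subspace spanned by [R]. *)
Section Presented.
Variables (K : fieldType) (X : choiceType) (R : set {malg K[X]}).

Definition presented := Quotient.quot (span_pred R).

HB.instance Definition _ := GRing.Zmodule.on presented.
HB.instance Definition _ := ZmodQuotient.on presented.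

Definition presented_scale (c : K) : presented -> presented :=
  fun x => \pi_(presented) (c *: repr x).

Lemma presented_pi_scale (c : K) (x : {malg K[X]}) :
  presented_scale c (\pi_(presented) x) = \pi_(presented) (c *: x).
Proof.
apply/eqP; rewrite /presented_scale -Quotient.idealrBE -scalerBr.
have [S0 SL] := lin_span_subspace R.
have /asboolP H : repr (\pi_(presented) x) - x \in span_pred R.
  by rewrite Quotient.idealrBE; apply/eqP; exact: reprK.
by apply/asboolP; rewrite -[_ *: _]addr0; apply: SL.
Qed.

Lemma presented_pi_surj (v : presented) : exists x, v = \pi_(presented) x.
Proof. by exists (repr v); rewrite reprK. Qed.

Lemma presented_piD (x y : {malg K[X]}) :
  \pi_(presented) (x + y) = \pi_(presented) x + \pi_(presented) y.
Proof. exact: (raddfD (\pi_(presented))). Qed.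

Fact presented_scaleA a b (v : presented) :
  presented_scale a (presented_scale b v) = presented_scale (a * b) v.
Proof.
by have [x ->] := presented_pi_surj v; rewrite !presented_pi_scale scalerA.
Qed.

Fact presented_scale1 : left_id 1 presented_scale.
Proof.
by move=> v; have [x ->] := presented_pi_surj v;
  rewrite presented_pi_scale scale1r.
Qed.

Fact presented_scaleDr : right_distributive presented_scale +%R.
Proof.
move=> c u v; have [x ->] := presented_pi_surj u.
have [y ->] := presented_pi_surj v.
by rewrite -presented_piD !presented_pi_scale scalerDr presented_piD.
Qed.

Fact presented_scaleDl v :
  {morph presented_scale^~ v : a b / a + b}.
Proof.
move=> a b; have [x ->] := presented_pi_surj v.
by rewrite !presented_pi_scale scalerDl presented_piD.
Qed.

HB.instance Definition _ := GRing.Zmodule_isLmodule.Build K presented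
  presented_scaleA presented_scale1 presented_scaleDr presented_scaleDl.

Definition gen (x : X) : presented := \pi_(presented) << x >>.

End Presented.

Section Tensor.
Variables (K : fieldType).

Definition bilin_rel (U U' : lmodType K) : set {malg K[(U * U')%type]} :=
  [set r | (exists c x y z,
              r = << (c *: x + y, z) >> - c *: << (x, z) >> - << (y, z) >>)
        \/ (exists c x y z,
              r = << (z, c *: x + y) >> - c *: << (z, x) >> - << (z, y) >>)].

Definition tprod (U U' : lmodType K) : lmodType K :=
  presented (@bilin_rel U U').

Definition tpair (U U' : lmodType K) (x : U) (y : U') : tprod U U' :=
  gen (@bilin_rel U U') (x, y).

(** The empty word is killed, so that only the tensor powers [p >= 1] remain. *)
Definition tens_rel (W : lmodType K) : set {malg K[seq W]} :=
  [set r | r = << [::] >>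
        \/ (exists (s t : seq W) (c : K) (x y : W),
              r = << s ++ (c *: x + y) :: t >>
                  - c *: << s ++ x :: t >> - << s ++ y :: t >>)].

(** [TW W] is the direct sum of the tensor powers of [W] of order [p >= 1], and
    [tens [:: w_1; ...; w_p]] is the tensor [w_1 (x) ... (x) w_p]. *)
Definition TW (W : lmodType K) : lmodType K := presented (@tens_rel W).

Definition tens (W : lmodType K) (s : seq W) : TW W := gen (@tens_rel W) s.

(** The linear map satisfying [P]; used where [P] prescribes the values of a
    linear map on a spanning set, so that there is exactly one such map. *)
Definition the_linear (U U' : lmodType K) (P : set (U -> U')) : U -> U' :=
  xget (fun _ => 0) [set f | linear f /\ P f].

Definition projW (W : lmodType K) : TW W -> W :=
  the_linear [set f | (forall w, f (tens [:: w]) = w)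
                   /\ (forall s, size s != 1%N -> f (tens s) = 0)].

End Tensor.

Notation deg n := 'rV[int]_n.

Definition pairing (n : nat) (x y : deg n) : int := \sum_i x 0 i * y 0 i.

(** [(A, a)] as an element of Z^(n+1). *)
Definition bideg (n : nat) (A : deg n) (a : nat) : deg (n + 1) :=
  row_mx A (a%:Z)%:M.

Definition e1 (n : nat) : deg n.+1 := delta_mx 0 0.

Section Grading.
Variables (K : fieldType) (n : nat).

(** [V] is the internal direct sum of the subspaces [homog G x]. *)
Record grading (V : lmodType K) := Grading {
  homog : deg n -> set V;
  hom_subspace : forall x, is_subspace (homog x);
  hom_span : forall v : V, exists (s : seq (deg n)) (c : deg n -> V),
    [/\ uniq s, forall x, homog x (c x) & v = \sum_(x <- s) c x];
  hom_indep : forall (s : seq (deg n)) (c : deg n -> V),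
    uniq s -> (forall x, homog x (c x)) -> \sum_(x <- s) c x = 0 ->
    forall x, x \in s -> c x = 0
}.

(** For a family [w] of [p] vectors and [I] a set of indices, [word w I] lists
    the [w i], [i \in I], by increasing index. *)
Definition word (T : Type) (p : nat) (w : 'I_p -> T) (I : {set 'I_p}) : seq T :=
  [seq w i | i <- enum I].

Definition homw (W : lmodType K) (G : grading W) (p : nat)
    (d : 'I_p -> deg n) (w : 'I_p -> W) : Prop := forall i, homog G (d i) (w i).

Definition sumdeg (p : nat) (d : 'I_p -> deg n) (I : {set 'I_p}) : deg n :=
  \sum_(i in I) d i.

Definition sg (z : int) : K := (-1) ^ z.

(** [I] and [J] being listed increasingly, the inversions of the concatenation
    [(I; J)] are the pairs [(i, j)] in [I x J] with [j < i]. *)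
Definition signature (p : nat) (I J : {set 'I_p}) : K :=
  \prod_(i in I) \prod_(j in J | (j < i)%N) (-1).

Definition koszul (p : nat) (d : 'I_p -> deg n) (I J : {set 'I_p}) : K :=
  \prod_(i in I) \prod_(j in J | (j < i)%N) sg (pairing (d i) (d j)).

Variables (W : lmodType K) (G : grading W).

(** The part of total degree [x] of [TW W]. *)
Definition thom (x : deg n) : set (TW W) :=
  lin_span [set t | exists (p : nat) (d : 'I_p -> deg n) (w : 'I_p -> W),
    [/\ homw G d w, sumdeg d [set: 'I_p]%SET = x
      & t = tens (word w [set: 'I_p]%SET)]].

Definition coproduct : TW W -> tprod (TW W) (TW W) :=
  the_linear [set D | forall (q : nat) (d : 'I_q.+1 -> deg n) (w : 'I_q.+1 -> W),
    homw G d w ->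
    D (tens (word w [set: 'I_q.+1]%SET)) =
    \sum_(I : {set 'I_q.+1})
      \sum_(J : {set 'I_q.+1} | [&& I != finset.set0, [disjoint I & J]
                                  & I :|: J == [set~ ord_max]%SET])
        koszul d I J *:
          tpair (tens (word w I)) (tens (rcons (word w J) (w ord_max)))].

(** The tensor product [f (x) g], [g] being of weight [Qg]. *)
Definition tmap (f g : TW W -> TW W) (Qg : deg n) :
    tprod (TW W) (TW W) -> tprod (TW W) (TW W) :=
  the_linear [set H | forall (x : deg n) (u v : TW W), thom x u ->
    H (tpair u v) = sg (pairing Qg x) *: tpair (f u) (g v)].

Definition is_coderivation (Qd : deg n) (Q : TW W -> TW W) : Prop :=
  [/\ linear Q,
      forall x t, thom x t -> thom (x + Qd) (Q t)
    & forall t, coproduct (Q t) =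
        tmap Q idfun 0 (coproduct t) + tmap idfun Q Qd (coproduct t)].

Definition corestr (Q : TW W -> TW W) (p : nat) (w : 'I_p -> W) : W :=
  projW (Q (tens (word w [set: 'I_p]%SET))).

Definition CoDer (Qd : deg n) (p : nat) (Q : TW W -> TW W) : Prop :=
  is_coderivation Qd Q /\
  forall q (w : 'I_q -> W), q != p -> corestr Q w = 0.

Definition gcomm (Q : TW W -> TW W) (Qd : deg n) (Q' : TW W -> TW W)
    (Qd' : deg n) : TW W -> TW W :=
  fun t => Q (Q' t) - sg (pairing Qd Qd') *: Q' (Q t).

Definition mmap (V : lmodType K) (a : nat) : Type := ('I_a.+1 -> V) -> V.

Definition upd (p : nat) (w : 'I_p -> W) (i : 'I_p) (x : W) : 'I_p -> W :=
  fun j => if j == i then x else w j.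

(** [M^{(A, a)}(W)] *)
Definition Mspace (A : deg n) (a : nat) (f : mmap W a) : Prop :=
  (forall (w : 'I_a.+1 -> W) (i : 'I_a.+1) (c : K) (x y : W),
     f (upd w i (c *: x + y)) = c *: f (upd w i x) + f (upd w i y)) /\
  (forall (d : 'I_a.+1 -> deg n) (w : 'I_a.+1 -> W),
     homw G d w -> homog G (A + sumdeg d [set: 'I_a.+1]%SET) (f w)).

(** [f] applied to a word, which is meant to be of length [a.+1]. *)
Definition mapp (a : nat) (f : mmap W a) (s : seq W) : W :=
  f (fun i => nth 0 s i).

Definition precedes (p : nat) (I J : {set 'I_p}) : bool :=
  [forall i in I, forall j in J, (i < j)%N].

(** The index sets of the sum over [I], [J], [K] (here [L]): [k_1] is the first
    element of [L]. *)
Definition unshuffle3 (p : nat) (I J L : {set 'I_p}) : bool :=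
  [&& L != finset.set0, [disjoint I & J], [disjoint I & L], [disjoint J & L],
      I :|: J :|: L == [set: 'I_p]%SET, precedes I L & precedes J L].

(** [jmap f A g B d v] is [(j_g f)(v_1 (x) ... (x) v_p)] for [f] of weight
    [(A, a)], [g] of weight [(B, b)] and [v i] of degree [d i]; it is meant for
    [p = a + b + 1], and then [f] and [g] are applied to words of lengths [a + 1]
    and [b + 1]. *)
Definition jmap (a : nat) (f : mmap W a) (A : deg n)
    (b : nat) (g : mmap W b) (B : deg n)
    (p : nat) (d : 'I_p -> deg n) (v : 'I_p -> W) : W :=
  sg (pairing A B) *:
  \sum_(I : {set 'I_p}) \sum_(J : {set 'I_p})
    \sum_(L : {set 'I_p} | unshuffle3 I J L && (#|J| == b))
      (sg (pairing B (sumdeg d I) + (b * #|I|)%N%:Z)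
       * signature I J * koszul d I J) *:
      mapp f (word v I ++
              mapp g (rcons (word v J) (head 0 (word v L))) ::
              behead (word v L)).

End Grading.

Section Stem.
Variables (K : fieldType) (n : nat) (V : lmodType K) (G : grading n.+1 V).

Definition desusp_homog (x : deg n.+1) : set V := homog G (x + e1 n).

Fact desusp_span (v : V) : exists (s : seq (deg n.+1)) (c : deg n.+1 -> V),
  [/\ uniq s, forall x, desusp_homog x (c x) & v = \sum_(x <- s) c x].
Proof.
have [s [c [us hc ->]]] := hom_span G v.
exists [seq x - e1 n | x <- s], (fun x => c (x + e1 n)); split=> //.
- by rewrite map_inj_uniq //; exact: addIr.
- by move=> x; exact: hc.
- by rewrite big_map; apply: eq_bigr => x _; rewrite subrK.
Qed.

Fact desusp_indep (s : seq (deg n.+1)) (c : deg n.+1 -> V) :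
  uniq s -> (forall x, desusp_homog x (c x)) -> \sum_(x <- s) c x = 0 ->
  forall x, x \in s -> c x = 0.
Proof.
move=> us hc s0 x xs.
have inj : injective (fun y => y + e1 n) by exact: addIr.
have u' : uniq [seq y + e1 n | y <- s] by rewrite map_inj_uniq.
have h' y : homog G y (c (y - e1 n)).
  by have := hc (y - e1 n); rewrite /desusp_homog subrK.
have z' : \sum_(y <- [seq y + e1 n | y <- s]) c (y - e1 n) = 0.
  by rewrite big_map -[RHS]s0; apply: eq_bigr => y _; rewrite addrK.
have := hom_indep u' h' z' (map_f (fun y => y + e1 n) xs).
by rewrite addrK.
Qed.

(** The desuspension has the same underlying space, so that the maps [down] and
    [up] are the identity on vectors and only degrees are shifted. *)
Definition desusp : grading n.+1 V :=
  @Grading K n.+1 V desusp_homog (fun x => hom_subspace G (x + e1 n))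
    desusp_span desusp_indep.

(** [up^{(x) p}] maps [w_1 (x) ... (x) w_p] to the same word of [V], with the
    sign coming from moving the j-th [up], of weight [e1], past the [w_i] with
    [i < j]; here [d] are the degrees in the desuspension. *)
Definition up_sign (p : nat) (d : 'I_p -> deg n.+1) : K :=
  \prod_(j < p) \prod_(i < p | (i < j)%N) sg K (pairing (e1 n) (d i)).

(** [phi_{(A, a)}(f)], which is the only element of the set below when
    [Mspace G A f] holds. *)
Definition phi (A : deg n.+1) (a : nat) (f : mmap V a) : TW V -> TW V :=
  xget (fun _ => 0) [set Q |
    CoDer desusp (A + e1 n *+ a) a.+1 Q /\
    forall (d : 'I_a.+1 -> deg n.+1) (w : 'I_a.+1 -> V), homw desusp d w ->
      corestr Q w = (-1) ^+ ((a * a.+1)./2)%N *: (up_sign d *: f w)].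

Definition phi_inv (A : deg n.+1) (a : nat) (Q : TW V -> TW V) : mmap V a :=
  xget (fun _ => 0) [set f | Mspace G A f /\ phi A f = Q].

Definition stem_bracket (A : deg n.+1) (a : nat) (f : mmap V a)
    (B : deg n.+1) (b : nat) (g : mmap V b) : mmap V (a + b)%N :=
  fun v => sg K (1 + pairing (e1 n *+ a) (e1 n *+ b + B)) *:
    phi_inv (A + B) (a := (a + b)%N)
      (gcomm (phi A f) (A + e1 n *+ a) (phi B g) (B + e1 n *+ b)) v.

End Stem.

(* Main.v *)
From mathcomp Require Import generic_quotient ring_quotient finmap monalg.
From mathcomp Require Import ring zify.
Require Import Defs.
From mathcomp Require Import all_boot all_order all_algebra.
From mathcomp Require Import boolp classical_sets.

Import GRing.Theory.
Local Open Scope ring_scope.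

Set Implicit Arguments.
Unset Strict Implicit.
Unset Printing Implicit Defensive.
Local Open Scope quotient_scope.

(** A coderivation of [T(W)] is determined by its corestrictions: every [t] in
    [T(W)] is the sum of its component in [W] and of [M (Delta t)], where [M]
    sends [u (x) v] to the product of [u] with the component of [v] in [W]
    ([reconstruct]), and [Delta] only produces shorter words, so that induction
    on the length applies ([coder_eq]).  Conversely any multilinear [q] extends
    to a coderivation ([coder_ex]).  The commutator of two coderivations is a
    coderivation ([gcomm_coder]), hence applying the inverse of [phi] to
    [[phi f, phi g]] amounts to projecting [[phi f, phi g] (w)] to [W], for words
    [w] of length [a + b + 1], up to the sign built into [phi]
    ([phi_inv_gcomm]).  The projection of [phi f (phi g w)] is the sum over
    [I, J < K] of [f (W_I (x) g (W_J (x) w_k1) (x) W_K')], with Koszul signs of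
    the desuspension ([projW_phi_phi], [coder_sum_sets]), and the theorem becomes
    a comparison of signs.

    For the comparison, let [d_i = v_i - e1] be the degrees in the desuspension
    and [mu_i = <e1, d_i>].  Then [<d_i, d_j>] is congruent to
    [<v_i, v_j> + 1 + mu_i + mu_j] modulo 2.  Thus each inversion of [(I; J)]
    contributes the Koszul sign of [V], a factor [-1], all of which make up the
    signature, and a factor [(-1) ^ (mu_i + mu_j)].  The latter are absorbed by
    the signs of the three tensor powers of the suspension, which are also
    products of factors [(-1) ^ mu_i] ([unsh_sum_shifted_pairing]); what remains
    is independent of the unshuffle, except for the sign
    [(-1) ^ (<B, V_I> + b |I|)] of the statement ([term_sign]).

    The combinatorics of unshuffles is carried out by recursion on words.  A
    homogeneous word is a list of pairs (degree, vector), written with its last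
    letter at the head, because all sums in sight have a simple recursion in
    the last letter [x]: in an unshuffle of [w x] into [(I; J)] the letter [x]
    ends [I], in which case it crosses [J], or ends [J]; and
    [Q (w x) = Q (w) x + sum of +- w_I q (w_J x)].  The sums [unsh_sum] and
    [coder_sum] are given in continuation style, as functionals of the function
    to be summed, so that identities between them make sense for functions with
    values in any module and are proved by induction on the word.  In this form
    the coassociativity and cocommutativity of the unshuffle coproduct
    ([unsh_sumA], [unsh_sumC]) imply that [Q] is a coderivation of it
    ([coder_sum_unsh_sum]) and therefore of [Delta] ([coder_sum_coprod]).  The
    passage to [T(W)] rests on the fact that a linear map may be prescribed on
    homogeneous words ([TW_lift_homog]), and the passage to index sets on
    [unsh_sum_sets] and [big_unshuffle3]. *)

(** * Linear maps and signs *)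

Section Linear.
Variables (K : fieldType) (U U' : lmodType K) (f : U -> U').
Hypothesis f_lin : linear f.

Lemma lin0 : f 0 = 0.
Proof. by have := f_lin (-1) 0 0; rewrite scaleN1r oppr0 addr0 scaleN1r addNr. Qed.
Lemma linD u v : f (u + v) = f u + f v.
Proof. by rewrite -[u]scale1r f_lin !scale1r. Qed.
Lemma linZ c u : f (c *: u) = c *: f u.
Proof. by rewrite -[c *: u]addr0 f_lin lin0 addr0. Qed.
Lemma linB u v : f (u - v) = f u - f v.
Proof. by rewrite -scaleN1r linD linZ scaleN1r. Qed.
Lemma lin_sum I (r : seq I) (P : pred I) (F : I -> U) :
  f (\sum_(i <- r | P i) F i) = \sum_(i <- r | P i) f (F i).
Proof. exact: (big_morph _ linD lin0). Qed.
End Linear.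

Section Signs.
Variable K : fieldType.

Lemma sgD (x y : int) : sg K (x + y) = sg K x * sg K y.
Proof. by rewrite /sg expfzDr // oppr_eq0 oner_eq0. Qed.

Lemma sg0 : sg K 0 = 1. Proof. by []. Qed.

Lemma sg_sum (I : Type) (r : seq I) (P : pred I) (F : I -> int) :
  sg K (\sum_(i <- r | P i) F i) = \prod_(i <- r | P i) sg K (F i).
Proof. exact: (big_morph _ sgD sg0). Qed.

Lemma sg_double (x : int) : sg K (2 * x) = 1.
Proof. by rewrite /sg -exprz_exp -exprnP sqrrN expr1n exp1rz. Qed.

Lemma sg_sq (x : int) : sg K x * sg K x = 1.
Proof. by rewrite -sgD -mulr2n -mulr_natl sg_double. Qed.

Lemma eq_sg (x y : int) : (exists z, x = y + 2 * z) -> sg K x = sg K y.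
Proof. by case=> z ->; rewrite sgD sg_double mulr1. Qed.
End Signs.

(** * Unshuffles and coderivations of words *)
Section UnshuffleSums.
Variables (K : fieldType) (X : eqType) (beta : X -> X -> int).

Definition beta_sum (x : X) (s : seq X) : int := \sum_(y <- s) beta x y.

Lemma beta_sum_cons x y s : beta_sum x (y :: s) = beta x y + beta_sum x s.
Proof. by rewrite /beta_sum big_cons. Qed.

Lemma beta_sum_cat x s t : beta_sum x (s ++ t) = beta_sum x s + beta_sum x t.
Proof. by rewrite /beta_sum big_cat. Qed.

Lemma beta_sum_perm x s t : perm_eq s t -> beta_sum x s = beta_sum x t.
Proof. by move=> st; rewrite /beta_sum (perm_big _ st). Qed.

(** The sum of [eps (I; J) F(s_I, s_J)] over all splittings of the letters of
    [s] into [I] and [J].  The head [x] of the list is the last letter of the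
    word, so it crosses precisely the letters of [J] when it goes to [I]. *)
Fixpoint unsh_sum (U : lmodType K) (s : seq X) (F : seq X -> seq X -> U) : U :=
  if s is x :: s' then
    unsh_sum s' (fun I J => sg K (beta_sum x J) *: F (x :: I) J + F I (x :: J))
  else F [::] [::].

Section Theory.
Variable U : lmodType K.
Implicit Types F G : seq X -> seq X -> U.

(** The hypothesis [perm_eq] makes the sizes, total degrees and homogeneity of
    the two parts available under the sum. *)
Lemma eq_unsh_sum s F G :
  (forall I J, perm_eq (I ++ J) s -> F I J = G I J) -> unsh_sum s F = unsh_sum s G.
Proof.
elim: s F G => [|x s IH] F G FG /=; first exact: FG.
apply: IH => I J IJ; congr (_ *: _ + _); apply: FG; first by rewrite /= perm_cons.
by rewrite perm_catC /= perm_cons perm_catC.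
Qed.

Lemma unsh_sumD s F G : unsh_sum s (fun I J => F I J + G I J) =
  unsh_sum s F + unsh_sum s G.
Proof.
elim: s F G => //= x s IH F G; rewrite -IH; apply: eq_unsh_sum => I J _.
by rewrite scalerDr addrACA.
Qed.

Lemma unsh_sumZ s c F : unsh_sum s (fun I J => c *: F I J) = c *: unsh_sum s F.
Proof.
elim: s F => //= x s IH F; rewrite -IH; apply: eq_unsh_sum => I J _.
by rewrite scalerDr !scalerA mulrC.
Qed.

(** Coassociativity of the unshuffle coproduct: both sides sum over the
    splittings into three parts. *)
Lemma unsh_sumA s (F : seq X -> seq X -> seq X -> U) :
  unsh_sum s (fun I J => unsh_sum J (fun B C => F I B C)) =
  unsh_sum s (fun I J => unsh_sum I (fun A B => F A B J)).
Proof.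
elim: s F => //= x s IH F.
pose F' A B C := (sg K (beta_sum x B) * sg K (beta_sum x C)) *: F (x :: A) B C
  + sg K (beta_sum x C) *: F A (x :: B) C + F A B (x :: C).
transitivity (unsh_sum s (fun I J => unsh_sum J (F' I))).
  apply: eq_unsh_sum => I J _; rewrite -unsh_sumZ -unsh_sumD;
    apply: eq_unsh_sum => B C BC.
  by rewrite /F' -(beta_sum_perm x BC) beta_sum_cat sgD addrA.
rewrite IH; apply: eq_unsh_sum => A C _; rewrite -unsh_sumZ -unsh_sumD.
by apply: eq_unsh_sum => I B _; rewrite /F' scalerDr scalerA [in RHS]mulrC.
Qed.

Lemma unsh_sum_right_nil s (F : seq X -> U) :
  unsh_sum s (fun I J => if J is [::] then F I else 0) = F s.
Proof.
elim: s F => //= x s IH F; rewrite -(IH (fun I => F (x :: I))).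
apply: eq_unsh_sum => I [|y J] _; last by rewrite scaler0 addr0.
by rewrite /beta_sum big_nil scale1r addr0.
Qed.

Hypothesis betaC : forall x y, beta x y = beta y x.

(** Cocommutativity: exchanging the roles of [I] and [J] replaces the crossings
    of [(I; J)] by the complementary pairs in [I x J]. *)
Lemma unsh_sumC s F :
  unsh_sum s F = unsh_sum s (fun I J => sg K (\sum_(x <- I) beta_sum x J) *: F J I).
Proof.
elim: s F => [|x s IH] F /=; first by rewrite big_nil scale1r.
rewrite IH; apply: eq_unsh_sum => I J _; rewrite big_cons scalerDr !scalerA addrC.
congr (_ *: _ + _ *: _); first by rewrite sgD mulrA sg_sq mul1r.
rewrite -sgD; congr (sg K _); under [in RHS]eq_bigr => y _ do rewrite beta_sum_cons.
by rewrite big_split addrC; congr (_ + _); apply: eq_bigr => y _; exact: betaC.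
Qed.
End Theory.

Section Coderivation.
(** Here [q] stands for the corestriction of a coderivation [Q], and [theta x]
    for the exponent of the sign of moving [Q] past the letter [x]. *)
Variables (q : seq X -> X) (theta : X -> int).
Definition theta_sum (s : seq X) : int := \sum_(x <- s) theta x.

Lemma theta_sum_cons x s : theta_sum (x :: s) = theta x + theta_sum s.
Proof. by rewrite /theta_sum big_cons. Qed.

Lemma theta_sum_cat s t : theta_sum (s ++ t) = theta_sum s + theta_sum t.
Proof. by rewrite /theta_sum big_cat. Qed.

Lemma theta_sum_perm s t : perm_eq s t -> theta_sum s = theta_sum t.
Proof. by move=> st; rewrite /theta_sum (perm_big _ st). Qed.

(** [F] applied to [Q s]: either the last letter [x] is kept, or it is the last
    argument of [q], and then it is preceded by the letters of [J]. *)
Fixpoint coder_sum (U : lmodType K) (s : seq X) (F : seq X -> U) : U :=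
  if s is x :: s' then
    coder_sum s' (fun t => F (x :: t))
    + unsh_sum s' (fun I J => sg K (theta_sum I) *: F (q (x :: J) :: I))
  else 0.

Variable U : lmodType K.

(** The words of [Q s] have the form [I q(J x) R], read from left to right. *)
Lemma eq_coder_sum s (F G : seq X -> U) :
  (forall R I x J, perm_eq (R ++ (x :: J) ++ I) s ->
     F (R ++ q (x :: J) :: I) = G (R ++ q (x :: J) :: I)) ->
  coder_sum s F = coder_sum s G.
Proof.
elim: s F G => //= x s IH F G FG; congr (_ + _).
  by apply: IH => R I y J p; apply: (FG (x :: R)); rewrite /= perm_cons.
apply: eq_unsh_sum => I J p; congr (_ *: _); apply: (FG [::]) => /=.
by rewrite perm_cons perm_catC.
Qed.

Lemma coder_sumD s (F G : seq X -> U) :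
  coder_sum s (fun t => F t + G t) = coder_sum s F + coder_sum s G.
Proof.
elim: s F G => [|x s IH] F G /=; first by rewrite addr0.
rewrite IH addrACA -unsh_sumD; congr (_ + _); apply: eq_unsh_sum => I J _.
by rewrite scalerDr.
Qed.

Lemma coder_sumZ s c (F : seq X -> U) : coder_sum s (fun t => c *: F t) =
  c *: coder_sum s F.
Proof.
elim: s F => [|x s IH] F /=; first by rewrite scaler0.
rewrite IH scalerDr -unsh_sumZ; congr (_ + _); apply: eq_unsh_sum => I J _.
by rewrite !scalerA mulrC.
Qed.

Hypothesis betaC : forall x y, beta x y = beta y x.
Hypothesis beta_q : forall s y, beta (q s) y = theta y + \sum_(x <- s) beta x y.

Lemma beta_sum_q s t : beta_sum (q s) t = theta_sum t + \sum_(x <- s) beta_sum x t.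
Proof.
rewrite /beta_sum /theta_sum exchange_big -big_split; apply: eq_bigr => y _.
exact: beta_q.
Qed.

(** Coassociativity, when the sign of moving [Q] past a word is distributed over
    the two parts of that word. *)
Lemma unsh_sumA_theta_sum s (F : seq X -> seq X -> seq X -> U) :
  unsh_sum s (fun I J => sg K (theta_sum I) *: unsh_sum I (fun A B => F A B J)) =
  unsh_sum s (fun I J => sg K (theta_sum I) *: unsh_sum J (fun A B =>
    sg K (theta_sum A) *: F I A B)).
Proof.
transitivity (unsh_sum s (fun I J => unsh_sum I (fun A B =>
    (sg K (theta_sum A) * sg K (theta_sum B)) *: F A B J))).
  apply: eq_unsh_sum => I J _; rewrite -unsh_sumZ; apply: eq_unsh_sum => A B p.
  by rewrite -(theta_sum_perm p) theta_sum_cat sgD.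
rewrite -(unsh_sumA s (fun A B J =>
  (sg K (theta_sum A) * sg K (theta_sum B)) *: F A B J)).
apply: eq_unsh_sum => I J _; rewrite -unsh_sumZ; apply: eq_unsh_sum => A B _.
by rewrite scalerA.
Qed.

(** [Q] is a coderivation of the unshuffle coproduct.  By induction only the
    terms in which [q] absorbs the last letter [x] matter.  If [q(J x)] falls in
    the right factor, the two sides agree by coassociativity; if it falls in the
    left factor, the letters of the right factor also have to be moved past [J],
    which is cocommutativity. *)
Lemma coder_sum_unsh_sum s (F : seq X -> seq X -> U) :
  coder_sum s (fun t => unsh_sum t F) =
  unsh_sum s (fun I J => coder_sum I (fun I' => F I' J)
                     + sg K (theta_sum I) *: coder_sum J (fun J' => F I J')).
Proof.
elim: s F => [|x s IH] F; first by rewrite /= scaler0 addr0.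
rewrite [LHS]/= IH.
transitivity (unsh_sum s (fun I J =>
    (sg K (beta_sum x J) *: coder_sum I (fun I' => F (x :: I') J)
     + (sg K (theta_sum I) * sg K (theta x + beta_sum x J)) *: coder_sum J (F (x :: I)))
  + (coder_sum I (fun I' => F I' (x :: J))
     + sg K (theta_sum I) *: coder_sum J (fun J' => F I (x :: J'))))
  + unsh_sum s (fun I J => sg K (theta_sum I) *: unsh_sum I (fun A B =>
      sg K (beta_sum (q (x :: J)) B) *: F (q (x :: J) :: A) B))
  + unsh_sum s (fun I J => sg K (theta_sum I) *: unsh_sum I (fun A B =>
      F A (q (x :: J) :: B)))).
  (* The terms in which [x] is kept, to which the induction hypothesis applies. *)
  rewrite -addrA; congr (_ + _); last first.
    by rewrite -unsh_sumD; apply: eq_unsh_sum => I J _; rewrite -scalerDr -unsh_sumD.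
  apply: eq_unsh_sum => I J _.
  rewrite !coder_sumD coder_sumZ -!scalerA [RHS]addrACA.
  congr (_ + _); rewrite -scalerDr -coder_sumZ; congr (_ *: (_ + _)).
  apply: eq_coder_sum => R A y B p; congr (sg K _ *: _).
  rewrite beta_sum_cat beta_sum_cons betaC beta_q -(beta_sum_perm x p) !beta_sum_cat.
  rewrite (_ : \sum_(_ <- _) _ = beta_sum x (y :: B)); first by ring.
  by apply: eq_bigr => z _; rewrite betaC.
transitivity (unsh_sum s (fun I J =>
    (sg K (beta_sum x J) *: coder_sum I (fun I' => F (x :: I') J)
     + (sg K (theta_sum I) * sg K (theta x + beta_sum x J)) *: coder_sum J (F (x :: I)))
  + (coder_sum I (fun I' => F I' (x :: J))
     + sg K (theta_sum I) *: coder_sum J (fun J' => F I (x :: J'))))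
  + unsh_sum s (fun I J => sg K (beta_sum x J) *: unsh_sum I (fun A B =>
      sg K (theta_sum A) *: F (q (x :: B) :: A) J))
  + unsh_sum s (fun I J => sg K (theta_sum I) *: unsh_sum J (fun A B =>
      sg K (theta_sum A) *: F I (q (x :: B) :: A)))).
  congr (_ + _ + _).
    (* [q(J x)] in the left factor: the sign of [q(J x)] past [B] is that of [Q],
       [J] and [x] past [B], and the one of [Q] cancels. *)
    transitivity (unsh_sum s (fun I J => unsh_sum I (fun A B =>
      (sg K (theta_sum A) * sg K (beta_sum x B) * sg K (\sum_(y <- B) beta_sum y J)) *:
        F (q (x :: J) :: A) B))).
      apply: eq_unsh_sum => I J _; rewrite -unsh_sumZ; apply: eq_unsh_sum => A B p.
      rewrite scalerA; congr (_ *: _); rewrite -!sgD; apply: eq_sg.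
      rewrite beta_sum_q big_cons -(theta_sum_perm p) theta_sum_cat.
      rewrite (_ : \sum_(y <- J) beta_sum y B = \sum_(y <- B) beta_sum y J); last first.
        rewrite /beta_sum exchange_big; do 2!apply: eq_bigr => ? _; exact: betaC.
      by exists (theta_sum B); ring.
    rewrite -(unsh_sumA s (fun A B J => (sg K (theta_sum A) * sg K (beta_sum x B)
        * sg K (\sum_(y <- B) beta_sum y J)) *: F (q (x :: J) :: A) B)).
    transitivity (unsh_sum s (fun I J => unsh_sum J (fun B C =>
      (sg K (beta_sum x C) * sg K (theta_sum I)) *: F (q (x :: B) :: I) C))).
      apply: eq_unsh_sum => I J _; rewrite [RHS](unsh_sumC betaC);
        apply: eq_unsh_sum => B C _.
      by rewrite scalerA; congr (_ *: _); ring.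
    rewrite unsh_sumA; apply: eq_unsh_sum => I J _; rewrite -unsh_sumZ;
      apply: eq_unsh_sum => A B _.
    by rewrite scalerA.
  (* [q(J x)] in the right factor. *)
  exact: (unsh_sumA_theta_sum s (fun A B J => F A (q (x :: J) :: B))).
rewrite /= -!unsh_sumD; apply: eq_unsh_sum => I J _.
rewrite theta_sum_cons !sgD !scalerDr !scalerA !addrA.
rewrite (_ : sg K (beta_sum x J) * _ = sg K (theta_sum I) * (sg K (theta x) * sg
  K (beta_sum x J)));
  last by ring.
congr (_ + _); rewrite -!addrA; congr (_ + _).
by rewrite [RHS]addrC -!addrA.
Qed.

(** In [Delta] the last letter stays in the right factor.  The summand with [I]
    empty is kept: it vanishes once words are read as tensors, since the empty
    word is zero in [T(W)]. *)
Definition coprod_sum (s : seq X) (F : seq X -> seq X -> U) : U :=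
  if s is x :: s' then unsh_sum s' (fun I J => F I (x :: J)) else 0.

Lemma coder_sum_coprod s (F : seq X -> seq X -> U) :
  coder_sum s (fun t => coprod_sum t F) =
  coprod_sum s (fun I J => coder_sum I (fun I' => F I' J)
                     + sg K (theta_sum I) *: coder_sum J (fun J' => F I J')).
Proof.
case: s => //= x s; rewrite (coder_sum_unsh_sum s (fun I J => F I (x :: J))) -unsh_sumD.
transitivity (unsh_sum s (fun I J => (coder_sum I (fun I' => F I' (x :: J)) +
    sg K (theta_sum I) *: coder_sum J (fun J' => F I (x :: J')))) +
  unsh_sum s (fun I J => sg K (theta_sum I) *: unsh_sum I (fun A B =>
    F A (q (x :: J) :: B)))).
  by rewrite -unsh_sumD.
rewrite (_ : unsh_sum s (fun I J => _ *: unsh_sum I _) = unsh_sum s (fun I J =>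
  sg K (theta_sum I) *: unsh_sum J (fun A B =>
      sg K (theta_sum A) *: F I (q (x :: B) :: A)))).
  by rewrite -unsh_sumD; apply: eq_unsh_sum => I J _; rewrite scalerDr addrA.
exact: (unsh_sumA_theta_sum s (fun A B J => F A (q (x :: J) :: B))).
Qed.
End Coderivation.
End UnshuffleSums.

Section LinearMaps.
Variables (K : fieldType) (X : eqType) (beta : X -> X -> int).
Variables (q : seq X -> X) (theta : X -> int).

Lemma unsh_sum_left_nil (U : lmodType K) s (F : seq X -> U) :
  unsh_sum beta s (fun I J => if I is [::] then F J else 0) = F s.
Proof.
elim: s F => //= x s IH F; rewrite -(IH (fun J => F (x :: J))).
by apply: eq_unsh_sum => I J _; rewrite scaler0 add0r.
Qed.

Lemma eq_coprod_sum (U : lmodType K) s (F F' : seq X -> seq X -> U) :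
  (forall I J, perm_eq (I ++ J) s -> (0 < size J)%N -> F I J = F' I J) ->
    coprod_sum beta s F = coprod_sum beta s F'.
Proof.
case: s => //= x s H; apply: eq_unsh_sum => I J p; apply: H => //.
by rewrite perm_catC /= perm_cons perm_catC.
Qed.

Lemma lin_unsh_sum (U U' : lmodType K) (f : U -> U') s F : linear f ->
  f (unsh_sum beta s F) = unsh_sum beta s (fun I J => f (F I J)).
Proof.
move=> lf; elim: s F => //= x s IH F; rewrite IH; apply: eq_unsh_sum => I J _.
exact: lf.
Qed.

Lemma lin_coprod_sum (U U' : lmodType K) (f : U -> U') s F : linear f ->
  f (coprod_sum beta s F) = coprod_sum beta s (fun I J => f (F I J)).
Proof. by move=> lf; case: s => [|x s] /=; [exact: lin0|exact: lin_unsh_sum]. Qed.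

Lemma lin_coder_sum (U U' : lmodType K) (f : U -> U') s F : linear f ->
  f (coder_sum beta q theta s F) = coder_sum beta q theta s (fun t => f (F t)).
Proof.
move=> lf; elim: s F => /= [|x s IH] F; first exact: lin0.
rewrite linD // IH lin_unsh_sum //; congr (_ + _); apply: eq_unsh_sum => I J _.
exact: linZ.
Qed.

Lemma coprod_sumD (U : lmodType K) s (F F' : seq X -> seq X -> U) :
  coprod_sum beta s (fun I J =>
    F I J + F' I J) = coprod_sum beta s F + coprod_sum beta s F'.
Proof. by case: s => [|x s] /=; [rewrite addr0|exact: unsh_sumD]. Qed.

Lemma eq_coprod_sumD (U : lmodType K) s (F F' H H' : seq X -> seq X -> U) :
  (forall I J, perm_eq (I ++ J) s -> (0 < size J)%N ->
    F I J + F' I J = H I J + H' I J) ->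
  coprod_sum beta s F + coprod_sum beta s F' = coprod_sum beta s H + coprod_sum
    beta s H'.
Proof. by move=> e; rewrite -!coprod_sumD; exact: eq_coprod_sum. Qed.

(** A sum with values in a subspace, the summands of which need only be known on
    the words that occur. *)
Lemma unsh_sum_closed (U : lmodType K) (S : set U) s (F : seq X -> seq X -> U) :
  is_subspace S -> (forall I J, perm_eq (I ++ J) s -> S (F I J)) ->
  S (unsh_sum beta s F).
Proof.
move=> [S0 SZ]; elim: s F => [|x s IH] F SF /=; first exact: SF.
apply: IH => I J p; apply: SZ; apply: SF; first by rewrite /= perm_cons.
by rewrite perm_catC /= perm_cons perm_catC.
Qed.

Lemma coder_sum_closed (U : lmodType K) (S : set U) s (F : seq X -> U) :
  is_subspace S ->
  (forall R x I J, perm_eq (R ++ (x :: J) ++ I) s -> S (F (R ++ q (x :: J) :: I))) ->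
  S (coder_sum beta q theta s F).
Proof.
move=> SS; have [S0 SZ] := SS; elim: s F => [|x s IH] F SF //=.
rewrite -[coder_sum _ _ _ _ _]scale1r; apply: (SZ).
  by apply: IH => R y I J p; apply: (SF (x :: R)); rewrite /= perm_cons.
apply: unsh_sum_closed => // I J p; rewrite -[_ *: _]addr0; apply: SZ => //.
by apply: (SF [::]); rewrite /= perm_cons perm_catC.
Qed.
End LinearMaps.

(** * Universal properties of the tensor constructions *)
Section PresentedLift.
Variables (K : fieldType) (X : choiceType) (U : lmodType K).
Implicit Types (phi : X -> U) (g : {malg K[X]}).

(** The linear extension of [phi] to the free module on [X]. *)
Definition mlift phi g : U := \sum_(k <- msupp g) g@_k *: phi k.

Lemma mliftEw phi g (d : {fset X}) : (msupp g `<=` d)%fset ->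
  mlift phi g = \sum_(k <- d) g@_k *: phi k.
Proof.
move=> le; rewrite /mlift (big_fset_incl _ le) // => k _ /mcoeff_outdom ->.
by rewrite scale0r.
Qed.

Lemma mlift_linear phi : linear (mlift phi).
Proof.
move=> c g1 g2; pose d := (msupp g1 `|` msupp g2 `|` msupp (c *: g1 + g2))%fset.
rewrite !(@mliftEw _ _ d) /d ?fsubsetUr //; last 2 first.
- by rewrite fsubsetU // fsubsetUr.
- by rewrite fsubsetU // fsubsetUl.
rewrite scaler_sumr -big_split; apply: eq_bigr => k _ /=.
by rewrite mcoeffD mcoeffZ scalerDl scalerA.
Qed.

Lemma mliftU phi k : mlift phi << k >> = phi k.
Proof. by rewrite /mlift msuppU oner_eq0 big_seq_fset1 mcoeffUU scale1r. Qed.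

Variable R : set {malg K[X]}.

Lemma piZD c (x y : {malg K[X]}) :
  \pi_(presented R) (c *: x + y) =
  c *: (\pi_(presented R) x : presented R) + \pi_(presented R) y.
Proof. by rewrite presented_piD -presented_pi_scale. Qed.

Lemma pi_linear : linear (fun x => \pi_(presented R) x : presented R).
Proof. by move=> c x y; exact: piZD. Qed.

Lemma pi_rel r : R r -> \pi_(presented R) r = 0.
Proof.
move=> Rr; rewrite -[RHS](raddf0 (\pi_(presented R))); apply/eqP.
rewrite -Quotient.idealrBE subr0; apply/asboolP => S _; exact.
Qed.

Lemma presented_lift phi : (forall r, R r -> mlift phi r = 0) ->
  exists2 L : presented R -> U, linear L & forall x, L (gen R x) = phi x.
Proof.
move=> Rphi; have lin := mlift_linear phi.
have wd x : mlift phi (repr (\pi_(presented R) x)) = mlift phi x.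
  apply/eqP; rewrite -subr_eq0 -(linB lin); apply/eqP.
  have /asboolP H : repr (\pi_(presented R) x) - x \in span_pred R.
    by rewrite Quotient.idealrBE; apply/eqP; exact: reprK.
  apply: (H [set g | mlift phi g = 0]%classic) => //; split; first exact: lin0.
  by move=> c u v /= u0 v0; rewrite lin u0 v0 scaler0 addr0.
exists (fun v => mlift phi (repr v)); last by move=> x; rewrite wd mliftU.
move=> c u v; have [x ->] := presented_pi_surj u; have [y ->] := presented_pi_surj v.
by rewrite -piZD !wd lin.
Qed.

Lemma presented_eq (L1 L2 : presented R -> U) : linear L1 -> linear L2 ->
  (forall x, L1 (gen R x) = L2 (gen R x)) -> L1 =1 L2.
Proof.
move=> l1 l2 eq12 v; have [g ->] := presented_pi_surj v.
have pi_lin := pi_linear.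
rewrite [g]monalgE (lin_sum pi_lin) (lin_sum l1) (lin_sum l2).
apply: eq_bigr => k _.
have -> : << g@_k *g k >> = g@_k *: << k >> :> {malg K[X]}.
  by apply/malgP => x; rewrite mcoeffZ !mcoeffU mulrnAr mulr1.
by rewrite (linZ pi_lin) (linZ l1) (linZ l2) eq12.
Qed.
End PresentedLift.

Section TensorLifts.
Variables (K : fieldType).

Section Tprod.
Variables (U U' E : lmodType K).

Lemma tpair_linl (v : U') : linear (fun u : U => tpair u v).
Proof.
move=> c x y; have := @pi_rel _ _ (@bilin_rel K U U') _ (or_introl
  (ex_intro _ c (ex_intro _ x (ex_intro _ y (ex_intro _ v erefl))))).
have pi_lin := @pi_linear K _ (@bilin_rel K U U').
rewrite !(linB pi_lin) (linZ pi_lin) => /eqP; rewrite -addrA -opprD subr_eq0.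
by move=> /eqP.
Qed.

Lemma tpair_linr (u : U) : linear (fun v : U' => tpair u v).
Proof.
move=> c x y; have := @pi_rel _ _ (@bilin_rel K U U') _ (or_intror
  (ex_intro _ c (ex_intro _ x (ex_intro _ y (ex_intro _ u erefl))))).
have pi_lin := @pi_linear K _ (@bilin_rel K U U').
rewrite !(linB pi_lin) (linZ pi_lin) => /eqP; rewrite -addrA -opprD subr_eq0.
by move=> /eqP.
Qed.

Lemma tprod_lift (phi : U -> U' -> E) :
  (forall v, linear (phi^~ v)) -> (forall u, linear (phi u)) ->
  exists2 L : tprod U U' -> E, linear L & forall u v, L (tpair u v) = phi u v.
Proof.
move=> l1 l2.
have [r Rr|L lL LE] := @presented_lift _ _ E (@bilin_rel K U U') (fun p => phi p.1 p.2).
  have lin := mlift_linear (fun p => phi p.1 p.2).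
  case: Rr => -[c [x [y [z ->]]]]; rewrite !(linB lin) (linZ lin) !mliftU /=.
    by rewrite l1 -addrA -opprD subrr.
  by rewrite l2 -addrA -opprD subrr.
by exists L => // u v; rewrite /tpair LE.
Qed.

Lemma tprod_eq (L1 L2 : tprod U U' -> E) : linear L1 -> linear L2 ->
  (forall u v, L1 (tpair u v) = L2 (tpair u v)) -> L1 =1 L2.
Proof. by move=> l1 l2 H; apply: presented_eq => // -[u v]; exact: H. Qed.
End Tprod.

Section Tens.
Variables (W E : lmodType K).

Definition multilinear (phi : seq W -> E) := forall s t c x y,
  phi (s ++ (c *: x + y) :: t) = c *: phi (s ++ x :: t) + phi (s ++ y :: t).

Lemma TW_lift (phi : seq W -> E) : multilinear phi -> phi [::] = 0 ->
  exists2 L : TW W -> E, linear L & forall s, L (tens s) = phi s.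
Proof.
move=> ml phi0.
have [r Rr|L lL LE] := @presented_lift _ _ E (@tens_rel K W) phi; last by exists L.
have lin := mlift_linear phi.
case: Rr => [->|[s [t [c [x [y ->]]]]]]; first by rewrite mliftU.
by rewrite !(linB lin) (linZ lin) !mliftU ml -addrA -opprD subrr.
Qed.

Lemma TW_eq_tens (L1 L2 : TW W -> E) : linear L1 -> linear L2 ->
  (forall s, L1 (tens s) = L2 (tens s)) -> L1 =1 L2.
Proof. by move=> l1 l2 H; apply: presented_eq => // s; exact: H. Qed.
End Tens.

Lemma tens0 (W : lmodType K) : tens [::] = 0 :> TW W.
Proof. by apply: pi_rel; left. Qed.

Lemma tens_multilinear (W : lmodType K) : multilinear (@tens K W).
Proof.
move=> s t c x y.
have := @pi_rel _ _ (@tens_rel K W) _ (or_intror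
  (ex_intro _ s (ex_intro _ t (ex_intro _ c (ex_intro _ x (ex_intro _ y erefl)))))).
have pi_lin := @pi_linear K _ (@tens_rel K W).
rewrite !(linB pi_lin) (linZ pi_lin) => /eqP; rewrite -addrA -opprD subr_eq0.
by move=> /eqP.
Qed.
End TensorLifts.

(** * Linear maps prescribed on homogeneous words *)
Section HomogeneousWords.
Variables (K : fieldType) (n : nat) (V : lmodType K) (G : grading n V).
Notation X := (deg n * V)%type.

Definition homog_word (s : seq X) := forall x, x \in s -> homog G x.1 x.2.

Lemma homog_word_cons x s : homog_word (x :: s) <-> homog G x.1 x.2 /\ homog_word s.
Proof.
split=> [H|[Hx H] y]; last by rewrite inE => /predU1P[->|/H].
by split=> [|y ys]; apply: H; rewrite inE ?eqxx ?ys ?orbT.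
Qed.

Lemma homog_word_cat s t : homog_word (s ++ t) <-> homog_word s /\ homog_word t.
Proof.
split=> [H|[Hs Ht] x]; last by rewrite mem_cat => /orP[/Hs|/Ht].
by split=> x xs; apply: H; rewrite mem_cat xs ?orbT.
Qed.

Lemma homog_word_perm s t : perm_eq s t -> homog_word s -> homog_word t.
Proof. by move=> st H x; rewrite -(perm_mem st); exact: H. Qed.

Fact decomposition_ex v : exists p : seq (deg n) * (deg n -> V),
  [/\ uniq p.1, forall x, homog G x (p.2 x) & v = \sum_(x <- p.1) p.2 x].
Proof. by have [s [c H]] := hom_span G v; exists (s, c). Qed.

Definition degrees (v : V) : seq (deg n) := (sval (cid (decomposition_ex v))).1.
Definition component (v : V) (x : deg n) : V :=
  if x \in degrees v then (sval (cid (decomposition_ex v))).2 x else 0.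

Lemma homog0 x : homog G x 0. Proof. by case: (hom_subspace G x). Qed.

Lemma homogZD x c u v : homog G x u -> homog G x v -> homog G x (c *: u + v).
Proof. by case: (hom_subspace G x) => _; apply. Qed.

Lemma component_spec v : [/\ uniq (degrees v), forall x, homog G x (component v x)
  & v = \sum_(x <- degrees v) component v x].
Proof.
rewrite /component /degrees; case: (cid _) => -[s c] /= [us hc vE].
split=> // [x|]; first by case: ifP => _; [exact: hc|exact: homog0].
by rewrite {1}vE big_seq [RHS]big_seq; apply: eq_bigr => x ->.
Qed.

(** Sums over the degrees of [v] may run over any larger set of degrees, which
    lets the decompositions of several vectors share one index set. *)
Lemma component_widen (E : nmodType) (H : deg n -> V -> E) v u :
  uniq u -> {subset degrees v <= u} -> (forall x, H x 0 = 0) ->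
  \sum_(x <- degrees v) H x (component v x) = \sum_(x <- u) H x (component v x).
Proof.
move=> uu sub H0; have [us _ _] := component_spec v.
rewrite [RHS](bigID (mem (degrees v))) /= [X in _ + X]big1 ?addr0; last first.
  by move=> x /negbTE nx; rewrite /component nx H0.
rewrite -[RHS]big_filter; apply: perm_big; apply: uniq_perm; rewrite ?filter_uniq //.
move=> x; rewrite mem_filter /=; case xs: (x \in degrees v) => //=.
by rewrite sub.
Qed.

Lemma component_unique v (c : deg n -> V) (u : seq (deg n)) : uniq u ->
  {subset degrees v <= u} -> (forall x, homog G x (c x)) -> v = \sum_(x <- u) c x ->
  forall x, x \in u -> component v x = c x.
Proof.
move=> uu sub hc vE x xu; apply/eqP; rewrite -subr_eq0; apply/eqP.
have [_ hv vE'] := component_spec v.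
apply: (@hom_indep _ _ _ G u (fun x => component v x - c x)) => //.
  move=> y; rewrite -scaleN1r addrC; exact: homogZD.
rewrite sumrB -vE -(@component_widen _ (fun _ y => y) v u) // -vE'.
by rewrite subrr.
Qed.

Variables (E : lmodType K).

(** The extension to all vectors of a function [H] that is only meaningful on
    homogeneous vectors, for instance because it involves signs. *)
Definition component_sum (H : deg n -> V -> E) (v : V) : E :=
  \sum_(x <- degrees v) H x (component v x).

(** Linear although the choice of the decomposition is not: by independence the
    components of [c *: v + w] are those of [v] and [w] combined. *)
Lemma component_sum_linear H : (forall x, linear (H x)) -> linear (component_sum H).
Proof.
move=> lH c v w; pose u := undup (degrees v ++ degrees w ++ degrees (c *: v + w)).
have uu : uniq u by exact: undup_uniq.
have H0 x : H x 0 = 0 by exact: lin0.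
have [s1 s2 s3] : [/\ {subset degrees v <= u}, {subset degrees w <= u}
    & {subset degrees (c *: v + w) <= u}].
  by split=> x xs; rewrite mem_undup !mem_cat xs ?orbT.
rewrite /component_sum !(@component_widen _ H _ u) // scaler_sumr -big_split.
apply: eq_big_seq => x xu /=; rewrite -lH; congr (H x _).
have [_ hv vE] := component_spec v; have [_ hw wE] := component_spec w.
apply: (component_unique (c := fun x =>
  c *: component v x + component w x) uu s3) => //.
  by move=> y; exact: homogZD.
rewrite big_split -scaler_sumr -!(@component_widen _ (fun _ y => y) _ u) //.
by rewrite -vE -wE.
Qed.

Lemma component_sum_homog H d v : (forall x, H x 0 = 0) -> homog G d v ->
  component_sum H v = H d v.
Proof.
move=> H0 hv; pose u := undup (d :: degrees v).
have uu : uniq u by exact: undup_uniq.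
have su : {subset degrees v <= u} by move=> x xs; rewrite mem_undup inE xs orbT.
have du : d \in u by rewrite mem_undup inE eqxx.
rewrite /component_sum (@component_widen _ H _ u) // (bigD1_seq d) //= big1 ?addr0.
  congr (H d _); rewrite (component_unique (c := fun x =>
    if x == d then v else 0) uu su) ?eqxx //.
    by move=> x; case: eqP => [->|_] //; exact: homog0.
  by rewrite (bigD1_seq d) //= eqxx big1 ?addr0 // => x /negbTE ->.
move=> x xd; have [_ _ vE] := component_spec v.
case xs: (x \in degrees v); last by rewrite /component xs.
rewrite (component_unique (c := fun x =>
  if x == d then v else 0) uu su) ?(negbTE xd) ?su //.
  by move=> y; case: eqP => [->|_] //; exact: homog0.
by rewrite (bigD1_seq d) //= eqxx big1 ?addr0 // => y /negbTE ->.
Qed.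

(** Letters carry their degree as a label, and linearity is in the vector for a
    fixed label; the labels are what signs depend on. *)
Definition letter_linear (F : seq X -> E) := forall s t d c x y,
  F (s ++ (d, c *: x + y) :: t) = c *: F (s ++ (d, x) :: t) + F (s ++ (d, y) :: t).

Fixpoint homog_ext (F : seq X -> E) (w : seq V) : E :=
  if w is v :: w' then component_sum (fun d x => homog_ext (fun l =>
    F ((d, x) :: l)) w') v
  else F [::].

Lemma homog_ext_lin c F1 F2 w :
  homog_ext (fun l => c *: F1 l + F2 l) w = c *: homog_ext F1 w + homog_ext F2 w.
Proof.
elim: w F1 F2 => //= v w IH F1 F2; rewrite /component_sum scaler_sumr -big_split.
by apply: eq_bigr => x _; exact: IH.
Qed.

Lemma letter_linear_cons F x : letter_linear F -> letter_linear (fun l => F (x :: l)).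
Proof. by move=> mF s t d c u v; exact: (mF (x :: s)). Qed.

Lemma letter_linear_head F w d : letter_linear F ->
  linear (fun x => homog_ext (fun l => F ((d, x) :: l)) w).
Proof.
move=> mF c x y; rewrite -homog_ext_lin; congr homog_ext; apply: funext => l.
exact: (mF [::]).
Qed.

Lemma homog_ext_multilinear F : letter_linear F -> multilinear (homog_ext F).
Proof.
move=> mF s; elim: s F mF => [|v s IH] F mF t c x y /=.
  by rewrite component_sum_linear // => d; exact: letter_linear_head.
rewrite /component_sum scaler_sumr -big_split; apply: eq_bigr => d _ /=.
by apply: IH; exact: letter_linear_cons.
Qed.

Lemma homog_ext_homog_word F s : letter_linear F -> homog_word s ->
  homog_ext F (unzip2 s) = F s.
Proof.
elim: s F => //= -[d v] s IH F mF /homog_word_cons[/= hv hs].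
rewrite (@component_sum_homog _ d) //; last by move=> x;
  apply: (lin0 (letter_linear_head _ _ mF)).
by rewrite IH //; exact: letter_linear_cons.
Qed.

(** The tensor of a word whose letters are listed from the last to the first. *)
Definition rtens (s : seq X) : TW V := tens (rev (unzip2 s)).

(** This is how the coproduct, the coderivations and the sign operators are
    constructed: their formulas contain signs, hence make sense on homogeneous
    words only, but they are linear in each letter. *)
Lemma TW_lift_homog F : letter_linear F -> F [::] = 0 ->
  exists2 L : TW V -> E, linear L & forall s, homog_word s -> L (rtens s) = F s.
Proof.
move=> mF F0; have mF' : letter_linear (F \o rev).
  by move=> s t d c x y; rewrite /= !rev_cat !rev_cons -!cats1 -!catA mF.
have [L lL LE] := TW_lift (homog_ext_multilinear mF') F0.
exists L => // s hs; rewrite LE /unzip2 -map_rev homog_ext_homog_word //= ?revK //.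
by apply: homog_word_perm hs; rewrite perm_sym perm_rev.
Qed.

(** The letters of [w] are expanded into homogeneous components one after the
    other, from the last one on. *)
Lemma TW_eq_size (L1 L2 : TW V -> E) w : linear L1 -> linear L2 ->
  (forall s, homog_word s -> size s = size w -> L1 (rtens s) = L2 (rtens s)) ->
  L1 (tens w) = L2 (tens w).
Proof.
move=> l1 l2 H.
have {}H s : homog_word s -> size s = size w ->
  L1 (tens (unzip2 s)) = L2 (tens (unzip2 s)).
  move=> hs sw; have := H (rev s); rewrite /rtens /unzip2 map_rev revK size_rev.
  by apply=> //; apply: homog_word_perm hs; rewrite perm_sym perm_rev.
suff /(_ w [::]) : forall t s, homog_word s -> size w = (size t + size s)%N ->
    L1 (tens (t ++ unzip2 s)) = L2 (tens (t ++ unzip2 s)).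
  by rewrite cats0 addn0; apply.
elim/last_ind => [|t v IH] s hs sE; first by apply: H.
rewrite cat_rcons; have [_ hv ->] := component_spec v.
have lin : linear (fun v => tens (t ++ v :: unzip2 s)).
  by move=> *; exact: tens_multilinear.
rewrite (lin_sum lin) (lin_sum l1) (lin_sum l2); apply: eq_bigr => x _.
apply: (IH ((x, component v x) :: s)); first by apply/homog_word_cons.
by rewrite sE size_rcons addnS.
Qed.

Lemma TW_eq (L1 L2 : TW V -> E) : linear L1 -> linear L2 ->
  (forall s, homog_word s -> L1 (rtens s) = L2 (rtens s)) -> L1 =1 L2.
Proof.
by move=> l1 l2 H; apply: TW_eq_tens => // w; apply: TW_eq_size => // s hs _; exact: H.
Qed.
End HomogeneousWords.

Lemma tprod_TW_eq (K : fieldType) n (V E : lmodType K) (G : grading n V)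
    (L1 L2 : tprod (TW V) (TW V) -> E) : linear L1 -> linear L2 ->
  (forall s t, homog_word G s -> homog_word G t ->
     L1 (tpair (rtens s) (rtens t)) = L2 (tpair (rtens s) (rtens t))) -> L1 =1 L2.
Proof.
move=> l1 l2 H; apply: tprod_eq => // u v.
have [lp lq] := (tpair_linl (U := TW V) (U' := TW V), tpair_linr (U := TW V) (U'
  := TW V)).
apply: (TW_eq (G := G) (L1 := fun u => L1 (tpair u v)) (L2 := fun u =>
  L2 (tpair u v))) => [c x y|c x y|s hs]; rewrite ?lp ?l1 ?l2 //.
apply: (TW_eq (G := G) (L1 := fun v => L1 (tpair _ v)) (L2 := fun v =>
  L2 (tpair _ v))) => [c x y|c x y|t ht]; rewrite ?lq ?l1 ?l2 //.
exact: H.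
Qed.

(** * Unshuffles as index sets *)
Section Words.
Variable p : nat.
Implicit Types I J : {set 'I_p}.

Lemma sorted_enum_ord I : sorted ltn [seq val i | i <- enum I].
Proof.
have -> : [seq val i | i <- enum I] = [seq i <- iota 0 p | i \in map val (enum I)].
  rewrite -val_enum_ord filter_map; congr (map _ _).
  rewrite {1}/enum_mem -enumT; apply: eq_filter => i /=.
  by rewrite mem_map ?mem_enum //; exact: val_inj.
by apply: sorted_filter; [exact: ltn_trans|exact: iota_ltn_sorted].
Qed.

(** Words list the elements of a set increasingly, so that an index larger than
    all others is appended. *)
Lemma enum_setU1_max (k : 'I_p) I : (forall i, i \in I -> (i < k)%N) ->
  enum (k |: I)%SET = rcons (enum I) k.
Proof.
move=> Ik; apply: (inj_map val_inj); apply: (irr_sorted_eq ltn_trans ltnn).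
- exact: sorted_enum_ord.
- rewrite (sorted_pairwise ltn_trans) map_rcons pairwise_rcons.
  rewrite -(sorted_pairwise ltn_trans) sorted_enum_ord andbT.
  by apply/allP => x /mapP[i]; rewrite mem_enum => /Ik ik ->.
- move=> x; apply/mapP/mapP => -[i];
  rewrite ?mem_rcons ?inE !mem_enum ?inE => iI ->; exists i => //.
    by rewrite mem_rcons inE mem_enum.
  by rewrite mem_enum !inE.
Qed.

Definition initial_seg (m : nat) : {set 'I_p} := [set i : 'I_p | (i < m)%N]%SET.

(** Only the splittings of initial segments are needed: in the sums over
    [I, J < K] the union of [I] and [J] is one. *)
Definition splits (m : nat) I J : bool :=
  [disjoint I & J] && (I :|: J == initial_seg m)%SET.

Lemma splitsP m I J : reflect
  (forall i, (i \in I) || (i \in J) = (i < m)%N /\ ~~ ((i \in I) && (i \in J)))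
  (splits m I J).
Proof.
apply: (iffP andP) => [[dIJ /eqP/setP UIJ] i|H].
  split; first by have := UIJ i; rewrite !inE.
  by apply/negP => /andP[iI]; rewrite (disjointFr dIJ iI).
split; last by apply/eqP/setP => i; rewrite !inE; case: (H i).
by rewrite disjoint_subset; apply/fintype.subsetP => i iI; have [_] := H i;
  rewrite iI inE.
Qed.

Lemma splitsC m I J : splits m I J = splits m J I.
Proof. by rewrite /splits disjoint_sym finset.setUC. Qed.

Fact ltnS_neq (i k : 'I_p) : i != k -> (i < k.+1)%N = (i < k)%N.
Proof. by move=> ik; rewrite ltnS leq_eqVlt (inj_eq val_inj) (negbTE ik). Qed.

Lemma splits_setU1 (k : 'I_p) I J :
  splits k.+1 (k |: I)%SET J && (((k |: I) :\ k)%SET == I) = splits k I J.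
Proof.
apply/andP/idP => [[/splitsP H /eqP/setP E]|/splitsP H].
  have kI : k \notin I by have := E k; rewrite !inE eqxx => <-.
  apply/splitsP => i; have [{}H1 H2] := H i; move: H1 H2; rewrite !inE.
  case: (eqVneq i k) => [->|ik] /=; last by rewrite ltnS_neq.
  by rewrite (negbTE kI) /= ltnn => _ /negbTE.
have [kU kD] := H k; rewrite ltnn in kU; have /norP[kI kJ] := negbT kU.
split.
  apply/splitsP => i; have [] := H i; rewrite !inE.
  case: (eqVneq i k) => [->|ik] /=; first by rewrite (negbTE kJ) ltnSn.
  by rewrite ltnS_neq.
apply/eqP/setP => i; rewrite !inE; case: eqVneq => [->|] //=.
by rewrite (negbTE kI).
Qed.

(** The last index [k] belongs to [I] or to [J], as in the recursion that
    defines [unsh_sum]. *)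
Lemma big_splits_recr (U : nmodType) (k : 'I_p) (H : {set 'I_p} -> {set 'I_p} -> U) :
  \sum_I \sum_(J | splits k.+1 I J) H I J =
  \sum_I \sum_(J | splits k I J) (H (k |: I)%SET J + H I (k |: J)%SET).
Proof.
rewrite !pair_big_dep /= (bigID (fun P : {set 'I_p} * {set 'I_p} =>
  k \in P.1)) /= big_split /=.
congr (_ + _).
  rewrite (reindex_onto (fun P => ((k |: P.1)%SET, P.2)) (fun P =>
    ((P.1 :\ k)%SET, P.2))) /=.
    apply: eq_bigl => -[I J] /=; rewrite setU11 andbT -splits_setU1.
    by rewrite xpair_eqE eqxx andbT.
  by move=> [I J] /= /andP[_ kI]; rewrite finset.setD1K.
rewrite (reindex_onto (fun P => (P.1, (k |: P.2)%SET)) (fun P =>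
  (P.1, (P.2 :\ k)%SET))) /=.
  apply: eq_bigl => -[I J] /=; rewrite [RHS]splitsC -splits_setU1.
  rewrite xpair_eqE eqxx /= splitsC; case S : (splits _ _ _) => //=.
  move/splitsP/(_ k): S => [_]; rewrite !inE eqxx /= => /negbTE ->.
  by [].
move=> [I J] /= /andP[/splitsP/(_ k)[E _] kI]; rewrite finset.setD1K //.
by move: E; rewrite (negbTE kI) ltnSn.
Qed.

Lemma splits0 I J : splits 0 I J = (I == finset.set0) && (J == finset.set0).
Proof.
apply/splitsP/andP => [H|[/eqP -> /eqP ->] i]; last by rewrite !inE.
by split; apply/eqP/setP => i; have [] := H i; rewrite !inE ltn0; case: (i \in I).
Qed.

Definition final_seg (k : 'I_p) : {set 'I_p} := [set i : 'I_p | (k <= i)%N]%SET.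

(** As [I] and [J] precede [L] and the three sets cover everything, [L] consists
    of the indices from its first element [k] on. *)
Lemma unshuffle3_final_seg (k : 'I_p) I J L : splits k I J ->
  unshuffle3 I J L = (L == final_seg k).
Proof.
move=> S; have [dIJ /eqP UIJ] := andP S.
apply/and5P/eqP => [[L0 _ dIL dJL /and3P[/eqP U _ _]]|->].
  apply/setP => i; rewrite inE leqNgt; have /setP/(_ i) := U; rewrite !inE.
  have [<- _] := splitsP _ _ _ S i; case iL: (i \in L); last by rewrite orbF => ->.
  by rewrite (disjointFl dIL iL) (disjointFl dJL iL).
have sub (A : {set 'I_p}) : A \subset initial_seg k ->
  [disjoint A & final_seg k] /\ precedes A (final_seg k).
  move=> /fintype.subsetP sA; split.
    rewrite disjoint_subset; apply/fintype.subsetP => i /sA; rewrite !inE.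
    by rewrite -ltnNge.
  apply/'forall_implyP => i /sA; rewrite inE => ik; apply/'forall_implyP => j.
  by rewrite inE; exact: leq_trans.
have [sI sJ] : I \subset initial_seg k /\ J \subset initial_seg k.
  by rewrite -UIJ finset.subsetUl finset.subsetUr.
have [[? ?] [? ?]] := (sub _ sI, sub _ sJ); split=> //.
  by apply/set0Pn; exists k; rewrite inE leqnn.
apply/and3P; split=> //; rewrite UIJ; apply/eqP/setP => i.
by rewrite !inE ltnNge orNb.
Qed.

Lemma unshuffle3_splits I J L : unshuffle3 I J L -> exists k : 'I_p, splits k I J.
Proof.
case/and5P => /set0Pn[l lL] dIJ dIL dJL /and3P[/eqP/setP U pI pJ].
case: (arg_minnP (fun i : 'I_p => val i) lL) => k kL kmin; exists k.
apply/andP; split=> //; apply/eqP/setP => i; rewrite !inE.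
have prec (A : {set 'I_p}) : precedes A L -> i \in A -> (i < k)%N.
  by move=> /'forall_implyP/(_ i) H /H /'forall_implyP/(_ k); apply.
apply/idP/idP => [/orP[]|ik]; [exact: prec|exact: prec|].
have := U i; rewrite !inE => /orP[//|/kmin]; by rewrite leqNgt ik.
Qed.

Lemma splits_inj (k k' : 'I_p) I J : splits k I J -> splits k' I J -> k = k'.
Proof.
move=> /andP[_ /eqP E1] /andP[_ /eqP]; rewrite E1 => /setP E; apply/val_inj/eqP.
rewrite eqn_leq leqNgt [in X in _ && X]leqNgt.
by have := E k; have := E k'; rewrite !inE !ltnn => -> <-.
Qed.

Lemma big_unshuffle3 (U : nmodType)
    (H : {set 'I_p} -> {set 'I_p} -> {set 'I_p} -> U) :
  \sum_I \sum_J \sum_(L | unshuffle3 I J L) H I J L =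
  \sum_(k < p) \sum_I \sum_(J | splits k I J) H I J (final_seg k).
Proof.
rewrite [RHS]exchange_big; apply: eq_bigr => I _.
rewrite [RHS](exchange_big_dep xpredT) //=; apply: eq_bigr => J _.
have [[k S]|no] := pselect (exists k : 'I_p, splits k I J).
  rewrite (big_pred1 (final_seg k)) => [|L]; last exact: unshuffle3_final_seg.
  rewrite (big_pred1 k) // => k' /=; apply/idP/eqP => [S'|-> //].
  exact: splits_inj S' S.
rewrite !big_pred0 // => [k|L]; apply/negP.
  by move=> S; apply: no; exists k.
by move/unshuffle3_splits.
Qed.

Lemma enum_final_seg (k : 'I_p) :
  enum (final_seg k) = k :: enum [set i : 'I_p | (k < i)%N]%SET.
Proof.
apply: (inj_map val_inj); apply: (irr_sorted_eq ltn_trans ltnn).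
- exact: sorted_enum_ord.
- rewrite (sorted_pairwise ltn_trans) /= -(sorted_pairwise ltn_trans).
  rewrite sorted_enum_ord andbT.
  by apply/allP => x /mapP[i]; rewrite mem_enum inE => ik ->.
- move=> x; apply/mapP/mapP => -[i];
    rewrite ?inE !mem_enum ?inE => iI ->; exists i => //.
    by rewrite inE mem_enum inE -val_eqE eq_sym /= -leq_eqVlt.
  by rewrite mem_enum inE leq_eqVlt eq_sym val_eqE.
Qed.

Lemma enum_split (k : 'I_p) :
  enum [set: 'I_p]%SET = enum (initial_seg k) ++ enum (final_seg k).
Proof.
apply: (inj_map val_inj); apply: (irr_sorted_eq ltn_trans ltnn).
- exact: sorted_enum_ord.
- rewrite map_cat (sorted_pairwise ltn_trans) pairwise_cat.
  rewrite -!(sorted_pairwise ltn_trans) !sorted_enum_ord !andbT.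
  apply/allrelP => _ _ /mapP[i + ->] /mapP[j + ->].
  by rewrite !mem_enum !inE; exact: leq_trans.
- move=> x; apply/mapP/mapP => -[i _ ->]; exists i => //; last by rewrite mem_enum inE.
  by rewrite mem_cat !mem_enum !inE; case: ltnP.
Qed.

Section UnshuffleSets.
Variables (K : fieldType) (X : eqType) (beta : X -> X -> int) (z : 'I_p -> X).

(** The Koszul sign, for an arbitrary exponent [beta]. *)
Definition inv_sign I J : K :=
  \prod_(i in I) \prod_(j in J | (j < i)%N) sg K (beta (z i) (z j)).

Lemma word_setU1 (k : 'I_p) I : I \subset initial_seg k ->
  word z (k |: I)%SET = rcons (word z I) (z k).
Proof.
move=> /fintype.subsetP Ik; rewrite /word enum_setU1_max ?map_rcons // => i /Ik.
by rewrite inE.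
Qed.

Lemma splits_sub m I J : splits m I J ->
  I \subset initial_seg m /\ J \subset initial_seg m.
Proof. by case/andP => _ /eqP <-; rewrite finset.subsetUl finset.subsetUr. Qed.

Lemma word_split (k : 'I_p) : word z [set: 'I_p]%SET =
  word z (initial_seg k) ++ z k :: behead (word z (final_seg k)).
Proof. by rewrite /word (enum_split k) map_cat enum_final_seg. Qed.

Lemma word_initial_seg (k : 'I_p) : word z (initial_seg k.+1) =
  rcons (word z (initial_seg k)) (z k).
Proof.
rewrite -word_setU1 //; congr (word z _); apply/setP => i.
by rewrite !inE ltnS leq_eqVlt.
Qed.

(** Both sides satisfy the same recursion in the last letter; for the left one
    this is [big_splits_recr], the last index being involved in no inversion
    when it belongs to [J]. *)
Lemma unsh_sum_sets (U : lmodType K) m (F : seq X -> seq X -> U) : (m <= p)%N ->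
  \sum_I \sum_(J | splits m I J) inv_sign I J *: F (word z I) (word z J) =
  unsh_sum beta (rev (word z (initial_seg m))) (fun s t => F (rev s) (rev t)).
Proof.
elim: m F => [|m IH] F mp.
  rewrite (_ : initial_seg 0 = finset.set0); last by apply/setP => i; rewrite !inE.
  rewrite {3}/word enum_set0 /= (bigD1 finset.set0) //= [X in _ + X]big1 ?addr0.
    rewrite (big_pred1 finset.set0) => [|J]; last by rewrite splits0 eqxx.
    by rewrite /inv_sign big_set0 scale1r /word enum_set0.
  by move=> I /negbTE I0; rewrite big_pred0 // => J; rewrite splits0 I0.
pose k := Ordinal mp;
  rewrite -[m]/(val k) big_splits_recr word_initial_seg rev_rcons /=.
pose F' s t := sg K (beta_sum beta (z k) t) *: F (rcons s (z k)) t + F s (rcons t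
  (z k)).
transitivity (unsh_sum beta (rev (word z (initial_seg k))) (fun s t =>
  F' (rev s) (rev t))); last first.
  apply: eq_unsh_sum => I J _; rewrite /F' -!rev_cons; congr (sg K _ *: _ + _).
  by apply: beta_sum_perm; rewrite perm_rev.
rewrite -IH 1?ltnW //; apply: eq_bigr => I _; apply: eq_bigr => J S.
have [sI sJ] := splits_sub S; rewrite !word_setU1 // /F' scalerDr scalerA.
have nk (A : {set 'I_p}) : A \subset initial_seg k -> k \notin A.
  by move=> /fintype.subsetP/(_ k) sA; apply/negP => /sA; rewrite inE ltnn.
congr (_ *: _ + _ *: _); rewrite /inv_sign.
  rewrite big_setU1 ?nk //= mulrC; congr (_ * _);
    rewrite sg_sum big_map big_enum_cond /=.
  apply: eq_bigl => j; case jJ: (j \in J) => //=.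
  by have := elimT fintype.subsetP sJ _ jJ; rewrite inE.
apply: eq_bigr => i iI; apply: eq_bigl => j; rewrite !inE.
case: eqVneq => [->|] //=; rewrite (negbTE (nk _ sJ)) ltnNge.
by have := elimT fintype.subsetP sI _ iI; rewrite inE => /ltnW ->.
Qed.

Definition between (k : 'I_p) (m : nat) : {set 'I_p} :=
  [set i : 'I_p | (k < i < m)%N]%SET.

Variables (q : seq X -> X) (theta : X -> int).

(** Unrolling the recursion of [coder_sum]: [k] is the index of the letter
    absorbed by [q], and the later letters are kept. *)
Lemma coder_sum_initial_seg (U : lmodType K) m (F : seq X -> U) : (m <= p)%N ->
  coder_sum beta q theta (rev (word z (initial_seg m))) F =
  \sum_(k < p | (k < m)%N) unsh_sum beta (rev (word z (initial_seg k))) (fun s t =>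
    sg K (theta_sum theta s) *: F (rev (word z (between k m)) ++ q (z k :: t) :: s)).
Proof.
elim: m F => [|m IH] F mp.
  rewrite (_ : initial_seg 0 = finset.set0); last by apply/setP => i; rewrite !inE.
  by rewrite /word enum_set0 /= big_pred0.
pose l := Ordinal mp; rewrite -[m]/(val l) word_initial_seg rev_rcons /= IH 1?ltnW //.
rewrite [RHS](bigD1 l) //= [RHS]addrC; congr (_ + _); last first.
  apply: eq_unsh_sum => I J _.
  rewrite (_ : between l m.+1 = finset.set0) /word ?enum_set0 //.
  by apply/setP => i; rewrite !inE /= ltnS; case: ltngtP.
apply: eq_big => k; first by rewrite -val_eqE /= ltnS [in RHS]leq_eqVlt; case: ltngtP.
move=> km; apply: eq_unsh_sum => I J _; rewrite -cat_cons; congr (_ *: F (_ ++ _)).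
rewrite -rev_rcons; congr rev.
have -> : between k m.+1 = (l |: between k m)%SET.
  apply/setP => i; rewrite !inE -val_eqE /= ltnS; case: (ltngtP i m) => [_|_|->];
    rewrite ?andbT ?andbF ?km //=.
rewrite word_setU1 //; apply/fintype.subsetP => i; by rewrite !inE => /andP[].
Qed.

Lemma coder_sum_sets (U : lmodType K) (F : seq X -> U) :
  coder_sum beta q theta (rev (word z [set: 'I_p]%SET)) F =
  \sum_(k < p) unsh_sum beta (rev (word z (initial_seg k))) (fun s t =>
    sg K (theta_sum theta s) *:
      F (rev (behead (word z (final_seg k))) ++ q (z k :: t) :: s)).
Proof.
rewrite (_ : [set: 'I_p]%SET = initial_seg p); last by apply/setP => i;
  rewrite !inE ltn_ord.
rewrite coder_sum_initial_seg //; apply: eq_big => k; first by rewrite ltn_ord.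
move=> _; apply: eq_unsh_sum => I J _; congr (_ *: F (rev _ ++ _)).
rewrite /word enum_final_seg /=; congr (map _ _); apply: eq_enum => i.
by rewrite !inE ltn_ord andbT.
Qed.
End UnshuffleSets.
End Words.

(** * The tensor coalgebra *)
Section Pairing.
Variable n : nat.
Implicit Types x y z : deg n.

Lemma pairingC x y : pairing x y = pairing y x.
Proof. by apply: eq_bigr => i _; rewrite mulrC. Qed.

Lemma pairingDl x y z : pairing (x + y) z = pairing x z + pairing y z.
Proof. by rewrite -big_split; apply: eq_bigr => i _; rewrite mxE mulrDl. Qed.

Lemma pairingDr x y z : pairing z (x + y) = pairing z x + pairing z y.
Proof. by rewrite !(pairingC z) pairingDl. Qed.

Lemma pairing0r x : pairing x 0 = 0.
Proof. by apply: big1 => i _; rewrite mxE mulr0. Qed.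

Lemma pairing_sumr (I : Type) (r : seq I) (P : pred I) (F : I -> deg n) x :
  pairing x (\sum_(i <- r | P i) F i) = \sum_(i <- r | P i) pairing x (F i).
Proof. exact: (big_morph _ (fun y z => pairingDr y z x) (pairing0r x)). Qed.
End Pairing.

Section TensorCoalgebra.
Variables (K : fieldType) (n : nat) (V : lmodType K) (G : grading n V).
Notation X := (deg n * V)%type.

Definition deg_pairing (x y : X) : int := pairing x.1 y.1.

Lemma deg_pairingC x y : deg_pairing x y = deg_pairing y x. Proof. exact: pairingC. Qed.

Definition word_degree (s : seq X) : deg n := \sum_(x <- s) x.1.

Lemma word_degree_cons x s : word_degree (x :: s) = x.1 + word_degree s.
Proof. by rewrite /word_degree big_cons. Qed.

Lemma word_degree_cat s t : word_degree (s ++ t) = word_degree s + word_degree t.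
Proof. by rewrite /word_degree big_cat. Qed.

Lemma word_degree_perm s t : perm_eq s t -> word_degree s = word_degree t.
Proof. by move=> st; rewrite /word_degree (perm_big _ st). Qed.

Lemma pairing_word_degree d s : pairing d (word_degree s) = \sum_(x <- s) pairing d x.1.
Proof. exact: pairing_sumr. Qed.

Lemma word_degree_unzip1 s t : unzip1 s = unzip1 t -> word_degree s = word_degree t.
Proof.
have E r : word_degree r = \sum_(x <- unzip1 r) x by rewrite big_map.
by rewrite !E => ->.
Qed.

Lemma beta_sum_word_degree x s : beta_sum deg_pairing x s = pairing x.1 (word_degree s).
Proof. by rewrite pairing_word_degree. Qed.

Section Multilinear.
Variable E : lmodType K.

Lemma letter_linear_scale (c : seq X -> K) (F : seq X -> E) :
  (forall s t, unzip1 s = unzip1 t -> c s = c t) -> letter_linear F ->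
  letter_linear (fun s => c s *: F s).
Proof.
move=> cE mF s t d a x y; rewrite mF scalerDr !scalerA.
have cE' u : c (s ++ (d, u) :: t) = c (s ++ (d, 0) :: t).
  by apply: cE; rewrite /unzip1 !map_cat.
by rewrite !cE' mulrC.
Qed.

Lemma letter_linearD (F F' : seq X -> E) : letter_linear F -> letter_linear F' ->
  letter_linear (fun s => F s + F' s).
Proof. by move=> mF mF' s t d a x y; rewrite mF mF' scalerDr addrACA. Qed.

Lemma letter_linear_unsh_sum (F : seq X -> seq X -> E) :
  (forall t, letter_linear (F^~ t)) -> (forall s, letter_linear (F s)) ->
  letter_linear (fun s => unsh_sum deg_pairing s F).
Proof.
move=> m1 m2 s; elim: s F m1 m2 => [|z s IH] F m1 m2 t d c x y /=.
  rewrite -unsh_sumZ -unsh_sumD; apply: eq_unsh_sum => I J _.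
  rewrite !beta_sum_word_degree /= (m1 _ [::]) (m2 _ [::]) !scalerDr !scalerA.
  by rewrite [_ * c]mulrC addrACA.
apply: IH => [l|l].
  apply: letter_linearD; last exact: m1.
  by apply: letter_linear_scale => //; exact: (letter_linear_cons _ (m1 l)).
apply: letter_linearD; last exact: (letter_linear_cons _ (m2 l)).
by apply: letter_linear_scale => // u v uv;
  rewrite !beta_sum_word_degree (word_degree_unzip1 uv).
Qed.

Lemma letter_linear_coprod_sum (F : seq X -> seq X -> E) :
  (forall t, letter_linear (F^~ t)) -> (forall s, letter_linear (F s)) ->
  letter_linear (fun s => coprod_sum deg_pairing s F).
Proof.
move=> m1 m2 [|z s] t d c x y /=.
  by rewrite -unsh_sumZ -unsh_sumD; apply: eq_unsh_sum => I J _; exact: (m2 _ [::]).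
by apply: letter_linear_unsh_sum => // l; exact: letter_linear_cons.
Qed.
End Multilinear.

Lemma rtens_letter_linear : letter_linear (@rtens K n V).
Proof.
move=> s t d c x y; rewrite /rtens /unzip2 !map_cat !rev_cat !rev_cons -!cats1 -!catA.
exact: tens_multilinear.
Qed.

Lemma rtens0 : rtens ([::] : seq X) = 0. Proof. exact: tens0. Qed.

Section Family.
Variables (p : nat) (d : 'I_p -> deg n) (w : 'I_p -> V).
Definition letters : 'I_p -> X := fun i => (d i, w i).

Lemma unzip2_letters I : unzip2 (word letters I) = word w I.
Proof. by rewrite /unzip2 /word -map_comp. Qed.

Lemma rtens_letters I : rtens (rev (word letters I)) = tens (word w I).
Proof. by rewrite /rtens /unzip2 -map_rev revK -[map _ _]/(unzip2 _)
  unzip2_letters. Qed.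

Lemma rtens_letters_rcons I (k : 'I_p) :
  rtens (rev (rcons (word letters I) (letters k))) = tens (rcons (word w I) (w k)).
Proof.
rewrite /rtens /unzip2 -map_rev revK map_rcons; congr (tens (rcons _ _)).
exact: unzip2_letters.
Qed.

Lemma koszul_letters I J : koszul K d I J = inv_sign K deg_pairing letters I J.
Proof. by []. Qed.

Lemma word_degree_letters I : word_degree (word letters I) = sumdeg d I.
Proof. by rewrite /word_degree big_map big_enum. Qed.

Lemma word_degree_rev s : word_degree (rev s) = word_degree s.
Proof. by apply: word_degree_perm; rewrite perm_rev. Qed.

Lemma homog_word_letters I : homw G d w -> homog_word G (word letters I).
Proof. by move=> h x /mapP[i _ ->]; exact: h. Qed.

Lemma homog_word_rev s : homog_word G s -> homog_word G (rev s).
Proof. by apply: homog_word_perm; rewrite perm_sym perm_rev. Qed.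
End Family.

(** Every homogeneous word comes from a family of homogeneous vectors, the form
    in which the coproduct and the corestrictions are specified. *)
Lemma lettersP (s : seq X) : homog_word G s -> exists d w,
  homw G d w /\ word (letters d w) [set: 'I_(size s)]%SET = s.
Proof.
move=> hs; pose d (i : 'I_(size s)) := (nth 0 s i).1.
pose w (i : 'I_(size s)) := (nth 0 s i).2; exists d, w; split=> [i|].
  exact: hs (mem_nth _ (ltn_ord i)).
rewrite /word enum_setT -enumT -[RHS](mkseq_nth 0) /mkseq -val_enum_ord -map_comp.
by apply: eq_map => i; rewrite /letters -surjective_pairing.
Qed.

Lemma rtens_thom s : homog_word G s -> thom G (word_degree s) (rtens s).
Proof.
move=> /homog_word_rev hs; have [d [w [h E]]] := lettersP hs.
move=> S _; apply; exists (size (rev s)), d, w; split=> //.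
  by rewrite -(word_degree_letters d w) E word_degree_rev.
by rewrite -(rtens_letters d) E revK.
Qed.

Lemma thom_ind x (S : set (TW V)) : is_subspace S ->
  (forall s, homog_word G s -> word_degree s = x -> S (rtens s)) ->
    forall t, thom G x t -> S t.
Proof.
move=> sS H t; apply=> // _ [p [d [w [h dx ->]]]].
rewrite -(rtens_letters d); apply: H; first by apply: homog_word_rev;
  exact: homog_word_letters.
by rewrite word_degree_rev word_degree_letters.
Qed.

Lemma thom_sub x : is_subspace (thom G x).
Proof. exact: lin_span_subspace. Qed.

Lemma the_linearP (U U' : lmodType K) (P : set (U -> U')) :
  (exists2 f, linear f & P f) -> linear (the_linear P) /\ P (the_linear P).
Proof.
move=> [f lf Pf].
exact: (@xgetPex _ (fun=> 0) [set f | linear f /\ P f]%classic (ex_intro _ f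
  (conj lf Pf))).
Qed.

Definition rtens_pair (s t : seq X) : tprod (TW V) (TW V) := tpair (rtens s) (rtens t).

Lemma rtens_pair0 t : rtens_pair [::] t = 0.
Proof. by rewrite /rtens_pair rtens0; exact: (lin0 (tpair_linl _)). Qed.

Lemma rtens_pair_linl t : letter_linear (rtens_pair^~ t).
Proof. by move=> *; rewrite /rtens_pair rtens_letter_linear tpair_linl. Qed.

Lemma rtens_pair_linr s : letter_linear (rtens_pair s).
Proof. by move=> *; rewrite /rtens_pair rtens_letter_linear tpair_linr. Qed.

(** The map with the prescribed values exists since [coprod_sum] is linear in
    each letter; as in [coprod_sum], the summands with [I] empty may be added. *)
Lemma coproductP : linear (coproduct G) /\
  forall s, homog_word G s ->
    coproduct G (rtens s) = coprod_sum deg_pairing s rtens_pair.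
Proof.
have [D lD DE] := TW_lift_homog G (letter_linear_coprod_sum rtens_pair_linl
  rtens_pair_linr) erefl.
have H q (d : 'I_q.+1 -> deg n) (w : 'I_q.+1 -> V) :
    coprod_sum deg_pairing (rev (word (letters d w) [set: 'I_q.+1]%SET)) rtens_pair =
    \sum_(I : {set 'I_q.+1})
      \sum_(J : {set 'I_q.+1} | [&& I != finset.set0, [disjoint I & J]
                                  & I :|: J == [set~ ord_max]%SET])
        koszul K d I J *:
          tpair (tens (word w I)) (tens (rcons (word w J) (w ord_max))).
  have -> : [set: 'I_q.+1]%SET = initial_seg q.+1 (@ord_max q).+1.
    by apply/setP => i; rewrite !inE ltn_ord.
  rewrite word_initial_seg rev_rcons /=.
  transitivity (unsh_sum deg_pairing (rev (word (letters d w) (initial_seg q.+1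
    (@ord_max q))))
    (fun s t => rtens_pair (rev (rev s)) (rev (rcons (rev t) (letters d w ord_max))))).
    by apply: eq_unsh_sum => s t _; rewrite rev_rcons !revK.
  rewrite -(unsh_sum_sets deg_pairing (letters d w) (fun s t =>
    rtens_pair (rev s) (rev (rcons t _)))); last exact: ltnW.
  apply: eq_bigr => I _; case: (eqVneq I finset.set0) => [->|I0] /=.
    rewrite [RHS]big_pred0_eq; apply: big1 => J _;
      rewrite [word _ finset.set0]/word enum_set0.
    by rewrite rtens_pair0 scaler0.
  apply: eq_big => [J|J _].
    rewrite /splits; congr (_ && (_ == _)); apply/setP => i; rewrite !inE.
    by rewrite -val_eqE /= ltn_neqAle -ltnS ltn_ord andbT.
  by rewrite /rtens_pair rtens_letters rtens_letters_rcons (koszul_letters d w).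
have /the_linearP[lc cE] : exists2 D : TW V -> tprod (TW V) (TW V), linear D &
  forall (q : nat) (d : 'I_q.+1 -> deg n) (w : 'I_q.+1 -> V),
    homw G d w ->
    D (tens (word w [set: 'I_q.+1]%SET)) =
    \sum_(I : {set 'I_q.+1})
      \sum_(J : {set 'I_q.+1} | [&& I != finset.set0, [disjoint I & J]
                                  & I :|: J == [set~ ord_max]%SET])
        koszul K d I J *:
          tpair (tens (word w I)) (tens (rcons (word w J) (w ord_max))).
  exists D => // q d w h; rewrite -H -(rtens_letters d) -DE //.
  by apply: homog_word_rev; exact: homog_word_letters.
split=> // s hs; have [d [w]] := lettersP (homog_word_rev hs).
case sE : (size (rev s)) d w => [|q] d w [h E].
  move: sE; rewrite size_rev => /eqP; rewrite size_eq0 => /eqP ->.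
  by rewrite rtens0; exact: (lin0 lc).
by rewrite -[s]revK -E rtens_letters H; exact: cE h.
Qed.

(** The sign in a tensor product of maps depends on the degree of the first
    factor.  Realising it as a linear operator on [T(W)] makes the tensor
    product of two maps defined on all tensors ([tmapP]). *)
Lemma sign_op (Qd : deg n) : exists2 S : TW V -> TW V, linear S &
  forall x t, thom G x t -> S t = sg K (pairing Qd x) *: t.
Proof.
have [||S lS SE] := @TW_lift_homog K n V G _ (fun s =>
  sg K (pairing Qd (word_degree s)) *: rtens s).
- by apply: letter_linear_scale rtens_letter_linear => s t /word_degree_unzip1 ->.
- by rewrite rtens0 scaler0.
exists S => // x.
apply: (@thom_ind x [set t | S t = sg K (pairing Qd x) *: t]%classic) => [|s hs <-];
  last exact: SE.
split=> [|c u v /= Su Sv]; first by rewrite /= (lin0 lS) scaler0.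
by rewrite lS Su Sv scalerDr !scalerA mulrC.
Qed.

Lemma tmapP (f g : TW V -> TW V) Qd : linear f -> linear g ->
  linear (tmap G f g Qd) /\ forall x u v, thom G x u ->
    tmap G f g Qd (tpair u v) = sg K (pairing Qd x) *: tpair (f u) (g v).
Proof.
move=> lf lg; apply: the_linearP; have [S lS SE] := sign_op Qd.
have [u c x y|v c x y|H lH HE] := @tprod_lift _ _ _ _ (fun u v =>
  tpair (f (S u)) (g v)).
- by rewrite lS lf tpair_linl.
- by rewrite lg tpair_linr.
exists H => // x u v hu; rewrite HE (SE _ _ hu) (linZ lf).
by rewrite (linZ (tpair_linl _)).
Qed.

Lemma projWP : [/\ linear (@projW K V), forall w : V, projW (tens [:: w]) = w
  & forall s : seq V, size s != 1%N -> projW (tens s) = 0].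
Proof.
have [||f lf fE] := @TW_lift _ V V (fun s => if s is [:: w] then w else 0) => //.
  move=> [|a [|b s]] [|e t] c x y //=; rewrite ?scaler0 ?addr0 //.
have [|l [H1 H2]] := @the_linearP _ _ [set f | (forall w, f (tens [:: w]) = w)
  /\ (forall s : seq V, size s != 1%N -> f (tens s) = 0)]%classic.
  by exists f => //; split=> [w|[|a [|b s]]] //; rewrite fE.
by split.
Qed.

Lemma projW_linear : linear (@projW K V). Proof. by case: projWP. Qed.

Lemma projW_rtens (s : seq X) : projW (rtens s) = if s is [:: x] then x.2 else 0.
Proof.
have [_ H1 H2] := projWP; rewrite /rtens; case: s => [|x [|y s]] /=.
- exact: H2.
- exact: H1.
- by apply: H2; rewrite size_rev.
Qed.

(** [u (x) v] is sent to the product of [u] with the component of [v] in [W],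
    the empty word not being a unit. *)
Lemma append_ex : exists2 M : tprod (TW V) (TW V) -> TW V, linear M &
  forall s t, M (rtens_pair s t) =
    if s is [::] then 0 else if t is [:: y] then rtens (y :: s) else 0.
Proof.
have R w : exists2 L : TW V -> TW V, linear L &
    forall s, L (tens s) = if s is [::] then 0 else tens (rcons s w).
  apply: (@TW_lift _ _ _ (fun s => if s is [::] then 0 else tens (rcons s w))) => //.
  move=> s t c x y.
  by case: s => [|a s]; rewrite /= ?rcons_cat ?rcons_cons -?cat_cons;
    [apply: (tens_multilinear [::])|apply: tens_multilinear].
pose L w := s2val (cid2 (R w)); have lL w : linear (L w) by exact: s2valP.
have LE w s : L w (tens s) = if s is [::] then 0 else tens (rcons s w).
  exact: (s2valP' (cid2 (R w))) s.
have LL u : linear (L^~ u).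
  move=> c x y; apply: (TW_eq_tens (lL _) (L2 := fun u => c *: L x u + L y u)).
    move=> a v w; rewrite !lL !scalerDr !scalerA [a * c]mulrC -!addrA.
    by congr (_ + _); rewrite addrCA.
  move=> [|a s]; rewrite !LE ?scaler0 ?addr0 // -!cats1.
  exact: tens_multilinear.
have [v c x y|u c x y|M lM ME] := @tprod_lift _ _ _ _ (fun u v => L (projW v) u).
- exact: lL.
- by rewrite projW_linear LL.
exists M => // s t; rewrite ME projW_rtens /rtens.
case: s t => [|a s] t; first by rewrite LE.
case: t => [|y [|z t]]; rewrite ?(lin0 (LL _)) // LE /= !rev_cons.
by case: (rev (unzip2 s)).
Qed.
End TensorCoalgebra.

(** * Coderivations of the tensor coalgebra *)
(** Let [h] and [h'] be the actions of [Q] and [Q'] on tensor products.  In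
    their commutator the terms [Q u (x) Q' v] and [Q' u (x) Q v] cancel, because
    [c], the sign of exchanging [Q] and [Q'], satisfies [c ^ 2 = 1]. *)
Lemma koszul_commutator (K : fieldType) (U E : lmodType K) (p : U -> U -> E)
    (h h' : E -> E) (Q Q' : U -> U) (s s' c : K) (u : U) :
  (forall v, linear (p^~ v)) -> (forall v, linear (p v)) -> linear h -> linear h' ->
  (forall v, h (p u v) = p (Q u) v + s *: p u (Q v)) ->
  (forall v, h' (p u v) = p (Q' u) v + s' *: p u (Q' v)) ->
  (forall v, h (p (Q' u) v) = p (Q (Q' u)) v + (s * c) *: p (Q' u) (Q v)) ->
  (forall v, h' (p (Q u) v) = p (Q' (Q u)) v + (s' * c) *: p (Q u) (Q' v)) ->
  c * c = 1 ->
  forall v, h (h' (p u v)) - c *: h' (h (p u v)) =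
    p (Q (Q' u) - c *: Q' (Q u)) v + (s * s') *: p u (Q (Q' v) - c *: Q' (Q v)).
Proof.
move=> pl pr lh lh' hE hE' hQ hQ' cc v.
rewrite hE' hE (linD lh) (linZ lh) (linD lh') (linZ lh') hQ hQ' hE hE'.
rewrite (linB (pl v)) (linZ (pl v)) (linB (pr u)) (linZ (pr u)).
rewrite !scalerDr !scalerN !scalerA !opprD [c * (s' * c)]mulrCA cc mulr1.
rewrite [c * s]mulrC [s' * s]mulrC [s * c * s']mulrAC -!addrA; congr (_ + _).
set x := (s * c) *: _; set y := s' *: _.
rewrite [- y + _]addrA -opprD [y + x]addrC addrA; move: (x + y) => z.
by rewrite [- (c *: _) + (- z + _)]addrCA [_ + (- z + _)]addrCA addNKr addrCA.
Qed.

(* These unfold to quotients and to choices of maps, which unification must not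
   explore. *)
Local Opaque tmap coproduct projW tpair tens.

Section Coderivations.
Variables (K : fieldType) (n : nat) (V : lmodType K) (G : grading n V).
Notation X := (deg n * V)%type.
Notation TV := (TW V).

(** On a word of length at least two, only the summand of the coproduct whose
    right factor is the last letter survives [M], and it gives the word back. *)
Lemma reconstruct : exists2 M : tprod TV TV -> TV, linear M &
  forall t : TV, t = tens [:: projW t] + M (coproduct G t).
Proof.
have [M lM ME] := append_ex n V; exists M => //.
have [lc cE] := coproductP G; have lp := @projW_linear K V.
have lt : linear (fun w : V => tens [:: w]).
  by move=> *; exact: (tens_multilinear [::]).
apply: (TW_eq (G := G) (L1 := id)) => [||s hs] //.
  move=> c x y; rewrite lp lt lc lM scalerDr -!addrA; congr (_ + _).
  by rewrite addrCA.
rewrite cE // lin_coprod_sum // projW_rtens; case: s hs => [|x [|y s]] hs.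
- by rewrite rtens0 (lin0 lt) addr0.
- by rewrite /= ME addr0.
- rewrite (lin0 lt) add0r -[LHS](unsh_sum_right_nil (@deg_pairing K n V) (y :: s)
  (fun I => rtens (x :: I))).
  apply: eq_unsh_sum => I J p; rewrite ME; case: I J p => [|z I] [|w J] p //.
  by move/perm_size: p.
Qed.

(** Strong induction on the length.  By [reconstruct] it suffices to compare
    the coproducts of the values, and in the coproduct of a word both maps are
    applied to shorter words; the right factor is the whole word only if the
    left one is empty, hence zero. *)
Lemma coder_eq Qd (Q1 Q2 : TV -> TV) :
  is_coderivation G Qd Q1 -> is_coderivation G Qd Q2 ->
  (forall s, homog_word G s -> projW (Q1 (rtens s)) = projW (Q2 (rtens s))) -> Q1 =1 Q2.
Proof.
move=> [l1 _ d1] [l2 _ d2] eq12; have [M lM ME] := reconstruct.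
have [lc cE] := coproductP G.
have lid : linear (@idfun TV) by [].
apply: (TW_eq (G := G)) => // s; have [m] := ubnP (size s);
  elim: m s => // m IH s sm hs.
rewrite [LHS]ME [RHS]ME (eq12 _ hs) d1 d2 (cE _ hs).
apply: (congr1 (fun u => _ + M u)).
have [[lt1 t1E] [lt1' t1E']] := (tmapP G 0 l1 lid, tmapP G Qd lid l1).
have [[lt2 t2E] [lt2' t2E']] := (tmapP G 0 l2 lid, tmapP G Qd lid l2).
rewrite (lin_coprod_sum _ _ _ lt1) (lin_coprod_sum _ _ _ lt1') (lin_coprod_sum _
  _ _ lt2) (lin_coprod_sum _ _ _ lt2').
apply: eq_coprod_sumD => I J p J0.
have [hI hJ] : homog_word G I /\ homog_word G J by
  apply/homog_word_cat/(homog_word_perm _ hs); rewrite perm_sym.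
have sIJ := perm_size p; rewrite size_cat in sIJ.
rewrite (t1E _ _ _ (rtens_thom hI)) (t2E _ _ _ (rtens_thom hI)).
rewrite (t1E' _ _ _ (rtens_thom hI)) (t2E' _ _ _ (rtens_thom hI)).
have sm' : (size s <= m)%N by [].
have -> : Q1 (rtens I) = Q2 (rtens I).
  by apply: IH hI; apply: leq_trans sm'; rewrite -sIJ -addn1 leq_add2l.
(* If [I] is empty then [J] has the length of [s], but the term is zero. *)
case: I {p} hI sIJ => [|x I] hI sIJ.
  by rewrite rtens0 !(lin0 (tpair_linl _)).
rewrite [Q1 (rtens J)](IH _ _ hJ) //; apply: leq_trans sm'.
by rewrite -sIJ /= addSn ltnS leq_addl.
Qed.

Section Existence.
Variables (Qd : deg n) (qv : seq X -> V).
(** The value of a map of weight [Qd] on a word, as a letter with its degree;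
    [qv] is the map on homogeneous words. *)
Definition image_letter (s : seq X) : X := (word_degree s + Qd, qv s).
Definition passing_exp (x : X) : int := pairing Qd x.1.

Lemma deg_pairing_image_letter s y : deg_pairing (image_letter s) y =
  passing_exp y + \sum_(x <- s) deg_pairing x y.
Proof.
rewrite /deg_pairing /= pairingDl addrC; congr (_ + _).
by rewrite pairingC pairing_word_degree; apply: eq_bigr => x _; rewrite pairingC.
Qed.

Lemma theta_sum_word_degree s : theta_sum passing_exp s = pairing Qd (word_degree s).
Proof. by rewrite pairing_word_degree. Qed.

Notation qs := (coder_sum (@deg_pairing K n V) image_letter passing_exp).

Hypothesis qv_linear : letter_linear qv.
Hypothesis qv_homog : forall s, homog_word G s -> homog G (word_degree s + Qd) (qv s).

Lemma letter_linear_coder_sum (E : lmodType K) (F : seq X -> E) : letter_linear F ->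
  letter_linear (fun s => qs s F).
Proof.
move=> mF s; elim: s F mF => [|z s IH] F mF t d c x y /=.
  rewrite scalerDr addrACA (_ : qs t _ = c *: qs t (fun t => F ((d, x) :: t))
    + qs t (fun t => F ((d, y) :: t))); last first.
    by rewrite -coder_sumZ -coder_sumD; apply: eq_coder_sum => *; exact: (mF [::]).
  congr (_ + _); rewrite -unsh_sumZ -unsh_sumD; apply: eq_unsh_sum => I J _.
  rewrite /image_letter (qv_linear [::]) !word_degree_cons /= (mF [::]) scalerDr
    !scalerA.
  by rewrite mulrC.
have mz : letter_linear (fun r => unsh_sum (@deg_pairing K n V) r (fun I J =>
    sg K (theta_sum passing_exp I) *: F (image_letter (z :: J) :: I))).
  apply: letter_linear_unsh_sum => [l|l].
    apply: letter_linear_scale; last exact: (letter_linear_cons _ mF).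
    by move=> u v /word_degree_unzip1; rewrite !theta_sum_word_degree => ->.
  move=> u v e a b b'; rewrite /image_letter -!cat_cons qv_linear.
  rewrite !(@word_degree_unzip1 _ _ _ ((z :: u) ++ (e, _) :: v) ((z :: u) ++ (e,
    0) :: v));
    try by rewrite /unzip1 !map_cat.
  by rewrite (mF [::]) scalerDr !scalerA mulrC.
by rewrite (IH _ (letter_linear_cons z mF)) mz scalerDr addrACA.
Qed.

(** The words occurring in [Q s] are homogeneous of the expected degree. *)
Lemma coder_sum_word s R x J I : homog_word G s -> perm_eq (R ++ (x :: J) ++ I) s ->
  homog_word G (R ++ image_letter (x :: J) :: I) /\
  word_degree (R ++ image_letter (x :: J) :: I) = word_degree s + Qd.
Proof.
move=> hs p; split.
  have : homog_word G (R ++ (x :: J) ++ I) by apply: homog_word_perm hs;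
    rewrite perm_sym.
  move=> /homog_word_cat[hR /homog_word_cat[hJ hI]]; apply/homog_word_cat; split=> //.
  by apply/homog_word_cons; split=> //; exact: qv_homog.
rewrite -(word_degree_perm p) !word_degree_cat [in LHS]word_degree_cons /=
  -!addrA; congr (_ + (_ + _)).
exact: addrC.
Qed.

(** Only the summand in which [q] absorbs the whole word has length one. *)
Lemma projW_coder_sum s : s != [::] -> projW (qs s (@rtens K n V)) = qv s.
Proof.
case: s => // x s _; rewrite (lin_coder_sum _ _ _ _ _ (@projW_linear K V)) /=.
rewrite (_ : qs s _ = 0) ?add0r; last first.
  rewrite -[RHS](scale0r (qs s (fun=> 0))) -coder_sumZ;
    apply: eq_coder_sum => R I y J _.
  by rewrite scale0r projW_rtens; case: R.
rewrite -[RHS](unsh_sum_left_nil (@deg_pairing K n V) s (fun J => qv (x :: J))).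
apply: eq_unsh_sum => -[|y I] J _; rewrite projW_rtens ?scaler0 //.
by rewrite theta_sum_word_degree /word_degree big_nil pairing0r scale1r.
Qed.

(** Evaluated on words, the coderivation property is [coder_sum_coprod]. *)
Lemma coder_ex : exists2 Q : TV -> TV, is_coderivation G Qd Q &
  forall s, homog_word G s -> Q (rtens s) = qs s (@rtens K n V).
Proof.
have [Q lQ QE] := TW_lift_homog G (letter_linear_coder_sum (@rtens_letter_linear
  K n V)) erefl.
exists Q => //; have [lc cE] := coproductP G.
have lid : linear (@idfun TV) by [].
have [[lt1 t1E] [lt1' t1E']] := (tmapP G 0 lQ lid, tmapP G Qd lid lQ).
split=> // [x|].
  apply: (@thom_ind _ _ _ G x [set t | thom G (x + Qd) (Q t)]%classic).
    have [S0 SZ] := thom_sub G (x + Qd); split=> /=; first by rewrite (lin0 lQ).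
    by move=> c u v /= hu hv; rewrite lQ; exact: SZ.
  move=> s hs <- /=; rewrite QE //.
  apply: (@coder_sum_closed K _ _ _ _ _ (thom G (word_degree s + Qd)) s (@rtens K
    n V) (thom_sub G _)) => R y I J p.
  have [h <-] := coder_sum_word hs p; exact: rtens_thom.
apply: (TW_eq (G := G)) => [c x y|c x y|s hs].
- by rewrite lQ lc.
- by rewrite lc lt1 lt1' scalerDr addrACA.
rewrite (QE _ hs) (cE _ hs) (lin_coprod_sum _ _ _ lt1) (lin_coprod_sum _ _ _
  lt1') -coprod_sumD (lin_coder_sum _ _ _ _ _ lc).
transitivity (qs s (fun t => coprod_sum (@deg_pairing K n V) t (@rtens_pair K n V))).
  by apply: eq_coder_sum => R I y J p; rewrite cE //; case: (coder_sum_word hs p).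
rewrite (coder_sum_coprod (@deg_pairingC K n V) deg_pairing_image_letter);
  apply: eq_coprod_sum => I J p _.
have [hI hJ] : homog_word G I /\ homog_word G J by
  apply/homog_word_cat/(homog_word_perm _ hs); rewrite perm_sym.
rewrite /rtens_pair (t1E _ _ _ (rtens_thom hI)) (t1E' _ _ _ (rtens_thom hI)) (QE
  _ hI) (QE _ hJ).
rewrite pairingC pairing0r scale1r theta_sum_word_degree /=.
have -> := @lin_coder_sum K _ (@deg_pairing K n V) image_letter passing_exp _ _
  (fun u => tpair u (rtens J)) I (@rtens K n V) (tpair_linl _).
by have -> := @lin_coder_sum K _ (@deg_pairing K n V) image_letter passing_exp _
  _ (tpair (rtens I)) J (@rtens K n V) (tpair_linr _).
Qed.
End Existence.

(** [Q] acts on tensor products by [h = Q (x) id + id (x) Q], likewise [Q'] by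
    [h'], and [Delta] intertwines [Q] with [h] and [Q'] with [h'].  So [Delta]
    intertwines the commutators, and [koszul_commutator] identifies the one of
    [h] and [h'] with the action of the commutator of [Q] and [Q']. *)
Lemma gcomm_coder Qd Qd' (Q Q' : TV -> TV) :
  is_coderivation G Qd Q -> is_coderivation G Qd' Q' ->
  is_coderivation G (Qd + Qd') (gcomm Q Qd Q' Qd').
Proof.
move=> [lQ wQ dQ] [lQ' wQ' dQ'].
have lid : linear (@idfun TV) by [].
have lC : linear (gcomm Q Qd Q' Qd').
  move=> c x y; rewrite /gcomm lQ' !lQ lQ' scalerDr scalerBr opprD !scalerA.
  by rewrite addrACA [_ * c]mulrC.
have [lc cE] := coproductP G.
have H (D : TV -> TV) Dd : linear D -> exists h, [/\ linear h,
    forall x u v, thom G x u ->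
      h (tpair u v) = tpair (D u) v + sg K (pairing Dd x) *: tpair u (D v)
    & forall x, h x = tmap G D idfun 0 x + tmap G idfun D Dd x].
  move=> lD; exists (fun x => tmap G D idfun 0 x + tmap G idfun D Dd x).
  have [[l1 E1] [l2 E2]] := (tmapP G 0 lD lid, tmapP G Dd lid lD).
  split=> [c x y|x u v hu|//]; first by rewrite l1 l2 scalerDr addrACA.
  by rewrite (E1 _ _ _ hu) (E2 _ _ _ hu) pairingC pairing0r scale1r.
have [[h [lh hE hQ]] [h' [lh' hE' hQ']]] := (H _ Qd lQ, H _ Qd' lQ').
have [h2 [lh2 hE2 hC]] := H _ (Qd + Qd') lC.
split=> [|x t ht|t]; first exact: lC.
  have [S0 SZ] := thom_sub G (x + (Qd + Qd')).
  rewrite /gcomm [_ - _]addrC -scaleNr; apply: SZ.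
    by rewrite addrA; apply: wQ'; exact: wQ.
  by rewrite [Qd + _]addrC addrA; apply: wQ; exact: wQ'.
transitivity (h2 (coproduct G t)); last exact: hC.
have dh u : coproduct G (Q u) = h (coproduct G u) by rewrite dQ hQ.
have dh' u : coproduct G (Q' u) = h' (coproduct G u) by rewrite dQ' hQ'.
rewrite /gcomm (linB lc) (linZ lc) dh (dh' (Q t)) dh' dh.
move: (coproduct G t); apply: (tprod_TW_eq (G := G)); [|exact: lh2|].
  move=> c x y; rewrite lh' lh (lh c) lh' scalerDr scalerBr opprD !scalerA.
  by rewrite addrACA [_ * c]mulrC.
move=> s r hs hr; have hu := rtens_thom hs.
rewrite (hE2 _ _ _ hu) pairingDl sgD.
apply: (@koszul_commutator K TV _ (@tpair K TV TV) h h' Q Q' _ _ _ (rtens s)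
  (@tpair_linl K TV TV) (@tpair_linr K TV TV) lh lh') => [w|w|w|w|].
- exact: hE.
- exact: hE'.
- by rewrite -sgD -pairingDr; exact: hE (wQ' _ _ hu).
- by rewrite (pairingC Qd) -sgD -pairingDr; exact: hE' (wQ _ _ hu).
- exact: sg_sq.
Qed.
End Coderivations.

Section Corestrictions.
Variables (K : fieldType) (n : nat) (V : lmodType K) (G : grading n V).
Notation X := (deg n * V)%type.

Lemma lettersP_size p (s : seq X) : size s = p -> homog_word G s -> exists d w,
  homw G d w /\ word (letters d w) [set: 'I_p]%SET = s.
Proof. by move=> <-; exact: lettersP. Qed.

Lemma size_word (T : Type) p (w : 'I_p -> T) : size (word w [set: 'I_p]%SET) = p.
Proof. by rewrite size_map -cardE cardsT card_ord. Qed.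

Lemma corestr_letters (Q : TW V -> TW V) p (d : 'I_p -> deg n) (w : 'I_p -> V) :
  corestr Q w = projW (Q (rtens (rev (word (letters d w) [set: 'I_p]%SET)))).
Proof. by rewrite rtens_letters. Qed.

Lemma CoDer_eq Qd p (Q1 Q2 : TW V -> TW V) :
  CoDer G Qd p Q1 -> CoDer G Qd p Q2 ->
  (forall (d : 'I_p -> deg n) w, homw G d w -> corestr Q1 w = corestr Q2 w) ->
  Q1 =1 Q2.
Proof.
move=> [c1 z1] [c2 z2] eq12; apply: (coder_eq c1 c2) => s hs.
have [d [w [h E]]] := lettersP_size (erefl (size (rev s))) (homog_word_rev hs).
rewrite -[s]revK -E -!corestr_letters.
case: (eqVneq (size (rev s)) p) => [e|ne]; last by rewrite z1 // z2.
by move: d w h {E}; rewrite e => d w h; exact: (eq12 d).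
Qed.

(** The vanishing of corestrictions concerns arbitrary families of vectors, but
    it can be tested on homogeneous words. *)
Lemma CoDer_of_coder Qd p Q : is_coderivation G Qd Q ->
  (forall s, homog_word G s -> size s != p -> projW (Q (rtens s)) = 0) ->
    CoDer G Qd p Q.
Proof.
move=> cQ Q0; split=> // q w qp; have [lQ _ _] := cQ.
rewrite /corestr; apply: (TW_eq_size (G := G) (L1 := fun t =>
  projW (Q t)) (L2 := fun=> 0)).
- by move=> c x y; rewrite lQ projW_linear.
- by move=> c x y; rewrite scaler0 addr0.
- by move=> s hs; rewrite size_word => sq; apply: Q0 => //; rewrite sq.
Qed.

Lemma projW_homog x t : thom G x t -> homog G x (projW t).
Proof.
apply: (@thom_ind _ _ _ G x [set t | homog G x (projW t)]%classic) => [|s hs <-] /=.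
  split=> [|c u v /= hu hv]; first by rewrite /= (lin0 (@projW_linear K V));
    exact: homog0.
  by rewrite projW_linear; exact: homogZD.
rewrite projW_rtens; case: s hs => [|y [|z s]] hs; try exact: homog0.
by have [] := (homog_word_cons G y [::]).1 hs; rewrite /word_degree big_seq1.
Qed.

Section Mapp.
Variables (A : deg n) (a : nat) (f : mmap V a).
Hypothesis hf : Mspace G A f.

Lemma mapp_word (w : 'I_a.+1 -> V) : mapp f (word w [set: 'I_a.+1]%SET) = f w.
Proof.
rewrite /mapp; congr f; apply: funext => i.
rewrite /word (nth_map i); last by rewrite -cardE cardsT card_ord.
by rewrite enum_setT -enumT nth_ord_enum.
Qed.

Lemma mapp_linear (s t : seq V) c x y : (size s + size t)%N = a ->
  mapp f (s ++ (c *: x + y) :: t) = c *: mapp f (s ++ x :: t) + mapp f (s ++ y :: t).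
Proof.
move=> st; have lt : (size s < a.+1)%N by rewrite ltnS -st leq_addr.
have E v : (fun i : 'I_a.+1 => nth 0 (s ++ v :: t) i) =
    upd (fun i : 'I_a.+1 => nth 0 (s ++ 0 :: t) i) (Ordinal lt) v.
  apply: funext => i; rewrite /upd -val_eqE /= !nth_cat; case: ltngtP => // [si|->].
    by case: (_ - _)%N (subn_gt0 (size s) i) => //; rewrite si.
  by rewrite subnn.
by rewrite /mapp (E (c *: x + y)) (E x) (E y) hf.1.
Qed.

Lemma mapp_homog (s : seq X) : size s = a.+1 -> homog_word G s ->
  homog G (A + word_degree s) (mapp f (unzip2 s)).
Proof.
move=> sa hs; have [d [w [h <-]]] := lettersP_size sa hs.
by rewrite unzip2_letters mapp_word word_degree_letters; exact: hf.2.
Qed.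

Lemma mapp0 (s t : seq V) : (size s + size t)%N = a -> mapp f (s ++ 0 :: t) = 0.
Proof.
move=> st; have := mapp_linear (-1) 0 0 st.
by rewrite scaler0 addr0 scaleN1r addNr.
Qed.
End Mapp.

Lemma word_upd p (w : 'I_p -> V) (i : 'I_p) : exists s t, forall x,
  word (upd w i x) [set: 'I_p]%SET = s ++ x :: t.
Proof.
pose e := enum [set: 'I_p]%SET; have ie : i \in e by rewrite mem_enum inE.
case/splitPr E : _ / ie => [e1 e2].
exists (map w e1), (map w e2) => x.
have updE e' : i \notin e' -> map (upd w i x) e' = map w e'.
  move=> ie; apply/eq_in_map => j je; rewrite /upd; case: eqP je => // ->.
  by rewrite (negbTE ie).
have : uniq e by exact: enum_uniq.
rewrite E cat_uniq /= => /and4P[_ /norP[i1 _] i2 _].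
rewrite /word -/e E map_cat /= !updE //; congr (_ ++ _ :: _).
by rewrite /upd eqxx.
Qed.
End Corestrictions.

(** * The coderivation of a multilinear map *)
Section Phi.
Variables (K : fieldType) (n : nat) (V : lmodType K) (G : grading n.+1 V).
Notation X := (deg n.+1 * V)%type.
Notation G' := (desusp G).

(** The exponent of the sign of the tensor power of the suspension: the factor
    belonging to the last letter passes all the other letters. *)
Fixpoint up_exp (s : seq X) : int :=
  if s is _ :: s' then up_exp s' + pairing (e1 n) (word_degree s') else 0.

Lemma up_exp_unzip1 s t : unzip1 s = unzip1 t -> up_exp s = up_exp t.
Proof.
elim: s t => [|x s IH] [|y t] //= [_ st].
by rewrite (IH _ st) (word_degree_unzip1 st).
Qed.

Lemma up_sign_letters p (d : 'I_p -> deg n.+1) (w : 'I_p -> V) :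
  up_sign K d = sg K (up_exp (rev (word (letters d w) [set: 'I_p]%SET))).
Proof.
have H m : (m <= p)%N -> \prod_(j < p | (j < m)%N) \prod_(i < p | (i < j)%N)
    sg K (pairing (e1 n) (d i)) = sg K (up_exp (rev (word (letters d w)
      (initial_seg p m)))).
  elim: m => [|m IH] mp.
    rewrite (_ : initial_seg p 0 = finset.set0); last by apply/setP => i; rewrite !inE.
    by rewrite /word enum_set0 big_pred0.
  pose k := Ordinal mp; rewrite -[m]/(val k) word_initial_seg rev_rcons /= sgD.
  rewrite (bigD1 k) //= mulrC; congr (_ * _).
    rewrite -IH 1?ltnW //; apply: eq_bigl => j.
    by rewrite -val_eqE /= ltnS [in RHS]ltn_neqAle andbC.
  rewrite -sg_sum -pairing_sumr word_degree_rev word_degree_letters;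
    congr (sg K (pairing _ _)).
  by apply: eq_bigl => i; rewrite inE.
rewrite (_ : [set: 'I_p]%SET = initial_seg p p); last by apply/setP => i;
  rewrite !inE ltn_ord.
by rewrite -H //; apply: eq_bigl => j; rewrite ltn_ord.
Qed.

Section PhiValue.
Variables (A : deg n.+1) (a : nat) (f : mmap V a).

Definition phi_weight : deg n.+1 := A + e1 n *+ a.

(** The corestriction of [phi f]. *)
Definition phi_value (s : seq X) : V :=
  if size s == a.+1 then
    ((-1) ^+ ((a * a.+1)./2)%N * sg K (up_exp s)) *: mapp f (rev (unzip2 s))
  else 0.

Hypothesis hf : Mspace G A f.

Lemma phi_value_letter_linear : letter_linear phi_value.
Proof.
move=> s t d c x y; rewrite /phi_value !size_cat /=.
case: eqP => [st|]; last by rewrite scaler0 addr0.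
rewrite !(@up_exp_unzip1 (s ++ (d, _) :: t) (s ++ (d, 0) :: t));
  try by rewrite /unzip1 !map_cat.
rewrite /unzip2 !map_cat /= !rev_cat !rev_cons -!cats1 -!catA /=.
rewrite (mapp_linear hf); first by rewrite scalerDr !scalerA mulrC.
by rewrite !size_rev !size_map addnC; apply/eqP; rewrite -eqSS -addnS; apply/eqP.
Qed.

Lemma homog_word_desusp s : homog_word G' s ->
  homog_word G [seq (x.1 + e1 n, x.2) | x <- s].
Proof. by move=> hs _ /mapP[x xs ->]; exact: hs. Qed.

Lemma phi_value_homog s : homog_word G' s ->
  homog G' (word_degree s + phi_weight) (phi_value s).
Proof.
move=> hs; rewrite /phi_value; case: eqP => [sa|_]; last exact: homog0.
rewrite -[_ *: _]addr0; apply: homogZD; last exact: homog0.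
have := mapp_homog hf (s := rev [seq (x.1 + e1 n, x.2) | x <- s]).
rewrite size_rev size_map => /(_ sa (homog_word_rev (homog_word_desusp hs))).
rewrite /unzip2 map_rev -map_comp word_degree_rev; congr homog.
rewrite /word_degree big_map big_split /= big_const_seq count_predT sa iter_addr_0.
rewrite /phi_weight mulrSr addrCA -!addrA; congr (_ + _).
Qed.

Lemma phi_value_letters (d : 'I_a.+1 -> deg n.+1) w :
  phi_value (rev (word (letters d w) [set: 'I_a.+1]%SET)) =
  (-1) ^+ ((a * a.+1)./2)%N *: (up_sign K d *: f w).
Proof.
rewrite /phi_value size_rev size_word eqxx /unzip2 -map_rev revK.
by rewrite -[map _ _]/(unzip2 _) unzip2_letters mapp_word scalerA -up_sign_letters.
Qed.

(** The choice made in [phi] is determined: a coderivation with the prescribed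
    corestrictions exists by [coder_ex] and is unique by [CoDer_eq]. *)
Lemma phiP : CoDer G' phi_weight a.+1 (phi G A f) /\
  forall s, homog_word G' s -> phi G A f (rtens s) =
    coder_sum (@deg_pairing K n.+1 V) (image_letter phi_weight phi_value)
      (passing_exp phi_weight) s
      (@rtens K n.+1 V).
Proof.
have [Q cQ QE] := coder_ex phi_value_letter_linear phi_value_homog.
have Q0 s : homog_word G' s -> size s != a.+1 -> projW (Q (rtens s)) = 0.
  move=> hs sa; rewrite QE //; case: s hs sa => [|x s] hs sa.
    by rewrite (lin0 (@projW_linear K V)).
  by rewrite projW_coder_sum // /phi_value (negbTE sa).
have CQ := CoDer_of_coder cQ Q0.
have QC (d : 'I_a.+1 -> deg n.+1) w : homw G' d w ->
    corestr Q w = (-1) ^+ ((a * a.+1)./2)%N *: (up_sign K d *: f w).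
  move=> h; rewrite (corestr_letters _ d) QE; last first.
    by apply: homog_word_rev; exact: homog_word_letters.
  rewrite projW_coder_sum ?phi_value_letters // -size_eq0 size_rev size_word //.
have [Cphi phiC] : CoDer G' phi_weight a.+1 (phi G A f) /\
    forall (d : 'I_a.+1 -> deg n.+1) (w : 'I_a.+1 -> V), homw G' d w ->
      corestr (phi G A f) w = (-1) ^+ ((a * a.+1)./2)%N *: (up_sign K d *: f w).
  apply: (@xgetPex _ (fun=> 0) [set Q | CoDer G' phi_weight a.+1 Q /\
    forall (d : 'I_a.+1 -> deg n.+1) (w : 'I_a.+1 -> V), homw G' d w ->
      corestr Q w = (-1) ^+ ((a * a.+1)./2)%N *: (up_sign K d *: f w)]%classic).
  by exists Q.
split=> // s hs; rewrite -QE //; apply: (CoDer_eq Cphi CQ) => d w h.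
by rewrite (phiC d w h) (QC d w h).
Qed.

Lemma projW_phi s : homog_word G' s -> projW (phi G A f (rtens s)) = phi_value s.
Proof.
move=> hs; rewrite phiP.2 //; case: s hs => [|x s] hs.
  by rewrite /= (lin0 (@projW_linear K V)).
by rewrite projW_coder_sum.
Qed.
End PhiValue.
End Phi.

(** * The commutator and its signs *)
Section Stem.
Variables (K : fieldType) (n : nat) (V : lmodType K) (G : grading n.+1 V).
Notation X := (deg n.+1 * V)%type.
Notation G' := (desusp G).
Notation e := (e1 n).

Section Composite.
Variables (A B : deg n.+1) (a b : nat) (f : mmap V a) (g : mmap V b).
Hypotheses (hf : Mspace G A f) (hg : Mspace G B g).
Notation QA := (phi_weight A a).
Notation QB := (phi_weight B b).
Notation qB := (image_letter QB (phi_value g)).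

Lemma projW_phi_phi s : homog_word G' s ->
  projW (phi G A f (phi G B g (rtens s))) =
  coder_sum (@deg_pairing K n.+1 V) qB (passing_exp QB) s (phi_value f).
Proof.
move=> hs; have [[[lA _ _] _] _] := phiP hf.
rewrite (phiP hg).2 // (lin_coder_sum _ _ _ _ _ lA).
rewrite (lin_coder_sum _ _ _ _ _ (@projW_linear K V)).
apply: eq_coder_sum => R x I J p; apply: projW_phi => //.
by have [] := coder_sum_word (phi_value_homog hg) hs p.
Qed.

(** A summand of [phi g] contributes only if [g] is applied to [b + 1] letters,
    and then the signs of [phi f] and [phi g] come out of the multilinear [f]. *)
Lemma phi_value_word R x J I :
  phi_value f (R ++ qB (x :: J) :: I) =
  if (size J == b) && (size I + size R == a)%N then
    (((-1) ^+ ((a * a.+1)./2)%N * sg K (up_exp (R ++ qB (x :: J) :: I))) *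
     ((-1) ^+ ((b * b.+1)./2)%N * sg K (up_exp (x :: J)))) *:
      mapp f (rev (unzip2 I) ++ mapp g (rcons (rev (unzip2 J)) x.2) :: rev (unzip2 R))
  else 0.
Proof.
rewrite {1}/phi_value size_cat /= addnS eqSS addnC [(size J == b) && _]andbC.
case: eqP => [aE|_] //=.
rewrite /unzip2 map_cat rev_cat /= rev_cons cat_rcons /phi_value /= eqSS.
have aE' : (size (rev (unzip2 I)) + size (rev (unzip2 R)) = a)%N.
  by rewrite !size_rev !size_map.
case: eqP => _; last by rewrite (mapp0 hf) ?scaler0.
rewrite -[_ *: mapp g _]addr0 (mapp_linear hf) // (mapp0 hf) // addr0 scalerA.
by rewrite rev_cons.
Qed.

Lemma projW_phi_phi0 s : homog_word G' s -> size s != (a + b).+1 ->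
  projW (phi G A f (phi G B g (rtens s))) = 0.
Proof.
move=> hs ne; rewrite projW_phi_phi // -[RHS](scale0r (coder_sum (@deg_pairing K
  n.+1 V) qB (passing_exp QB) s (fun=> 0))).
rewrite -coder_sumZ; apply: eq_coder_sum => R x I J p; rewrite scaler0 phi_value_word.
case: andP => // -[/eqP Jb /eqP Ia]; case/eqP: ne.
rewrite -(perm_size p) !size_cat /= Jb -Ia; lia.
Qed.

Lemma up_exp_cat (s t : seq X) :
  up_exp (s ++ t) = up_exp s + up_exp t + (size s)%:Z * pairing e (word_degree t).
Proof.
elim: s => [|x s IH] /=; first by rewrite mul0r add0r addr0.
by rewrite IH word_degree_cat pairingDr intS; ring.
Qed.

(** The exponent, in terms of the degrees in the desuspension, of the Koszul
    sign in [V] times [-1]: over the inversions of [(I; J)] it yields the Koszul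
    sign times the signature. *)
Definition shifted_pairing (x y : X) : int := pairing (x.1 + e) (y.1 + e) + 1.

Lemma pairing_e1 : pairing e e = 1.
Proof.
rewrite /pairing /e1 (bigD1 0) //= big1 ?addr0; first by rewrite !mxE !eqxx mulr1.
by move=> i i0; rewrite !mxE eqxx (negbTE i0) mul0r.
Qed.

Lemma beta_sum_shifted_pairing x s : beta_sum shifted_pairing x s =
  pairing x.1 (word_degree s) + (size s)%:Z * (pairing e x.1 + 2) + pairing e
    (word_degree s).
Proof.
elim: s => [|y s IH];
  first by rewrite /beta_sum /word_degree !big_nil !pairing0r mul0r !addr0.
rewrite beta_sum_cons IH word_degree_cons !pairingDr /shifted_pairing pairingDl
  !pairingDr pairing_e1 /=.
by rewrite intS (pairingC x.1 e); ring.
Qed.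

(** With [mu y = <e1, y>], the exponents [deg_pairing x y] and
    [shifted_pairing x y + mu x + mu y] have the same parity.  In the sum of
    [mu x + mu y] over the inversions, a letter of [J] is counted once for each
    later letter of [I], and a letter of [I] once for each earlier letter of [J].
    The numbers of later letters are what [up_exp] counts, and the earlier
    letters of [J] are the remaining ones among its [size J] letters. *)
Lemma unsh_sum_shifted_pairing (U : lmodType K) s (F : seq X -> seq X -> U) :
  unsh_sum (@deg_pairing K n.+1 V) s F =
  unsh_sum shifted_pairing s (fun I J => sg K (up_exp s + up_exp I + up_exp J
    + (size J)%:Z * pairing e (word_degree I)) *: F I J).
Proof.
elim: s F => [|x s IH] F /=; first by rewrite mul0r !addr0 sg0 scale1r.
rewrite IH; apply: eq_unsh_sum => I J p /=.
rewrite scalerDr !scalerA -!sgD; congr (_ *: _ + _ *: _).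
- rewrite beta_sum_word_degree beta_sum_shifted_pairing word_degree_cons
  pairingDr -(word_degree_perm p) word_degree_cat pairingDr.
  apply: eq_sg; exists (- (pairing e (word_degree I) + pairing e (word_degree J)
    + (size J)%:Z * pairing e x.1 + (size J)%:Z)); ring.
- rewrite -(word_degree_perm p) word_degree_cat pairingDr intS; apply: eq_sg.
  by exists (- (pairing e (word_degree I) + pairing e (word_degree J))); ring.
Qed.

Section Family.
Variables (p : nat) (d : 'I_p -> deg n.+1) (v : 'I_p -> V).
(** The letters of the desuspension: the same vectors, with degrees lowered by
    [e1]. *)
Definition down_letters : 'I_p -> X := letters (fun i => d i - e) v.
Notation z := down_letters.

Lemma inv_sign_shifted_pairing I J :
  inv_sign K shifted_pairing z I J = signature K I J * koszul K d I J.
Proof.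
rewrite /inv_sign /signature /koszul -big_split; apply: eq_bigr => i _ /=.
rewrite -big_split; apply: eq_bigr => j _ /=.
by rewrite /shifted_pairing /= !subrK sgD mulrC.
Qed.

Lemma sumdeg_down I : sumdeg d I = word_degree (word z I) + e *+ #|I|.
Proof.
rewrite word_degree_letters /sumdeg -sumr_const -big_split; apply: eq_bigr => i _ /=.
by rewrite subrK.
Qed.

Lemma homog_word_down : homw G d v -> homog_word G' (rev (word z [set: 'I_p]%SET)).
Proof.
move=> hv; apply: homog_word_rev; apply: homog_word_letters => i.
by rewrite /homog /= /desusp_homog subrK; exact: hv.
Qed.

Lemma jmap_unsh_sum :
  jmap f A g B d v = sg K (pairing A B) *:
    \sum_(k < p) unsh_sum shifted_pairing (rev (word z (initial_seg p k))) (fun s t =>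
      if size t == b then
        sg K (pairing B (word_degree s + e *+ size s) + (b * size s)%N%:Z) *:
        mapp f (rev (unzip2 s) ++ mapp g (rcons (rev (unzip2 t)) (v k))
                  :: behead (word v (final_seg k)))
      else 0).
Proof.
rewrite /jmap; congr (_ *: _).
pose H (I J L : {set 'I_p}) := if #|J| == b then (sg K (pairing B (sumdeg d I) +
  (b * #|I|)%N%:Z)
       * signature K I J * koszul K d I J) *:
      mapp f (word v I ++
              mapp g (rcons (word v J) (head 0 (word v L))) ::
              behead (word v L)) else 0.
transitivity (\sum_I \sum_J \sum_(L | unshuffle3 I J L) H I J L).
  by do 2!apply: eq_bigr => ? _; rewrite big_mkcondr.
rewrite big_unshuffle3; apply: eq_bigr => k _.
pose F (s t : seq X) :=
  if size t == b then
        sg K (pairing B (word_degree s + e *+ size s) + (b * size s)%N%:Z) *: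
        mapp f (unzip2 s ++ mapp g (rcons (unzip2 t) (v k))
                  :: behead (word v (final_seg k)))
  else 0.
transitivity (unsh_sum shifted_pairing (rev (word z (initial_seg p k))) (fun s t
  => F (rev s) (rev t))); last first.
  by apply: eq_unsh_sum => s t _; rewrite /F !size_rev word_degree_rev /unzip2 !map_rev.
rewrite -unsh_sum_sets; last exact: ltnW.
apply: eq_bigr => I _; apply: eq_bigr => J _; rewrite /H /F inv_sign_shifted_pairing.
rewrite !size_map -!cardE sumdeg_down !unzip2_letters; case: eqP => _;
  last by rewrite scaler0.
rewrite scalerA; congr (_ *: mapp f (_ ++ mapp g (rcons _ _) :: _)).
  by rewrite -mulrA mulrC.
by rewrite /word enum_final_seg.
Qed.
End Family.

Lemma sg_exp m : (-1) ^+ m = sg K m%:Z.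
Proof. by []. Qed.

(** This is why the signs [(-1) ^ (a (a + 1) / 2)] of [phi] leave the factor
    [(-1) ^ (a b)]. *)
Lemma triangle_add m l : (((m + l) * (m + l).+1)./2 =
  (m * m.+1)./2 + (l * l.+1)./2 + m * l)%N.
Proof.
have H r : ((r * r.+1)./2.*2 = r * r.+1)%N.
  by apply: even_halfK; rewrite oddM /=; case: odd.
by apply: double_inj; rewrite !doubleD !H -!muln2; ring.
Qed.

Lemma pairing_muln (x y : deg n.+1) m : pairing x (y *+ m) = m%:Z * pairing x y.
Proof.
elim: m => [|m IH]; first by rewrite mulr0n pairing0r mul0r.
by rewrite mulrS pairingDr IH intS mulrDl mul1r.
Qed.

(** The signs of one summand of [phi f (phi g w)], [w] being the word [I J x R]
    up to an unshuffle: those of the three tensor powers of the suspension, the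
    one relating the two kinds of Koszul signs, and that of [phi g] passing [I].
    Every exponent attached to the suspension occurs an even number of times,
    except for [(<e1, B> + b) |R|] and the [a b] of [triangle_add]; as
    [|R| = a - |I|], these add up to [(a + |I|) <e1, B> + b |I|] modulo 2. *)
Lemma term_sign (R : seq X) x (S I J : seq X) :
  perm_eq (I ++ J) S -> size J = b -> (size I + size R = a)%N ->
  (-1) ^+ (((a + b) * (a + b).+1)./2)%N * sg K (up_exp (R ++ x :: S))
  * sg K (up_exp S + up_exp I + up_exp J + (size J)%:Z * pairing e (word_degree I))
  * sg K (theta_sum (passing_exp QB) I)
  * (((-1) ^+ ((a * a.+1)./2)%N * sg K (up_exp (R ++ qB (x :: J) :: I))) *
     ((-1) ^+ ((b * b.+1)./2)%N * sg K (up_exp (x :: J)))) =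
  sg K (a%:Z * pairing e B) *
  sg K (pairing B (word_degree I + e *+ size I) + (b * size I)%N%:Z).
Proof.
move=> p Jb Ia; rewrite !sg_exp -!sgD; apply: eq_sg.
rewrite triangle_add !up_exp_cat /= theta_sum_word_degree !word_degree_cons /=
  !pairingDr.
rewrite !pairing_muln pairing_e1 -(word_degree_perm p) word_degree_cat !pairingDr.
rewrite ![pairing (B + _) _]pairingDl !(pairingC (e *+ b)) !pairing_muln.
rewrite (pairingC (word_degree I) e) (pairingC B e) Jb -Ia !PoszD !PoszM.
rewrite word_degree_cons !pairingDr.
(* Half of the difference of the two exponents. *)
exists ((((size I + size R) * (size I + size R).+1)./2)%:Z + ((b * b.+1)./2)%:Z
  + up_exp R + up_exp S + up_exp I + up_exp J
  + pairing e (word_degree I) + pairing e (word_degree J) + b%:Z * pairing e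
    (word_degree I)
  + (size R)%:Z * (pairing e x.1 + pairing e (word_degree I) + pairing e
    (word_degree J) + b%:Z)
  - (size I)%:Z * pairing e B).
ring.
Qed.

(** The length [p] is a variable, so that [f] and [g] can be exchanged although
    [a + b] and [b + a] are not convertible. *)
Lemma projW_phi_phi_jmap p (d : 'I_p -> deg n.+1) (v : 'I_p -> V) :
  p = (a + b).+1 -> homw G d v ->
  let s := rev (word (down_letters d v) [set: 'I_p]%SET) in
  ((-1) ^+ (((a + b) * (a + b).+1)./2)%N * sg K (up_exp s)) *:
    projW (phi G A f (phi G B g (rtens s))) =
  sg K (a%:Z * pairing e B + pairing A B) *: jmap f A g B d v.
Proof.
move=> pE hv s; rewrite projW_phi_phi; last exact: homog_word_down.
rewrite coder_sum_sets jmap_unsh_sum scalerA sgD -mulrA sg_sq mulr1 !scaler_sumr.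
apply: eq_bigr => k _; rewrite unsh_sum_shifted_pairing -!unsh_sumZ;
  apply: eq_unsh_sum => I J IJ.
set z := down_letters d v; set R := rev (behead (word z (final_seg k))).
have sE : s = R ++ z k :: rev (word z (initial_seg p k)).
  by rewrite /s (word_split _ k) rev_cat rev_cons cat_rcons.
have Ia : size J = b -> (size I + size R = a)%N.
  move=> Jb; have := congr1 size sE; rewrite size_rev size_word size_cat /=.
  rewrite -(perm_size IJ) size_cat Jb pE addnS addnCA addnA => -[/eqP].
  by rewrite eqn_add2r addnC eq_sym => /eqP.
rewrite phi_value_word.
have -> : (size J == b) && (size I + size R == a)%N = (size J == b).
  by case: eqP => //= /Ia ->; rewrite eqxx.
case: eqP => [Jb|_]; last by rewrite !scaler0.
have {}Ia := Ia Jb.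
rewrite !scalerA sE; congr (_ *: mapp f (_ ++ _ :: _)).
  by rewrite -(term_sign (z k) IJ Jb Ia) !mulrA.
by rewrite /R /unzip2 map_rev revK -behead_map -/(unzip2 _) unzip2_letters.
Qed.
End Composite.

Section Bracket.
Variables (A B : deg n.+1) (a b : nat) (f : mmap V a) (g : mmap V b).
Hypotheses (hf : Mspace G A f) (hg : Mspace G B g).
Notation QA := (phi_weight A a).
Notation QB := (phi_weight B b).
Notation C := (gcomm (phi G A f) QA (phi G B g) QB).

Lemma gcomm_CoDer : CoDer G' (phi_weight (A + B) (a + b)) (a + b).+1 C.
Proof.
have [[cA _] _] := phiP hf; have [[cB _] _] := phiP hg.
apply: CoDer_of_coder.
  have := gcomm_coder cA cB; congr is_coderivation.
  by rewrite /phi_weight mulrnDr addrACA.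
move=> s hs ss; rewrite /gcomm (linB (@projW_linear K V)) (linZ (@projW_linear K V)).
by rewrite !projW_phi_phi0 ?scaler0 ?subr0 // [(b + a)%N]addnC.
Qed.

(** The sign that [phi] puts between a multilinear map with [a + b + 1]
    arguments and its corestriction. *)
Definition bracket_coef (s : seq X) : K :=
  (-1) ^+ (((a + b) * (a + b).+1)./2)%N * sg K (up_exp s).

Lemma bracket_coef_sq s : bracket_coef s * bracket_coef s = 1.
Proof. by rewrite /bracket_coef sg_exp -sgD sg_sq. Qed.

(** The right-hand side is linear in each letter, so it defines a multilinear
    map [h] on all vectors.  By uniqueness of coderivations [phi h] is the
    commutator, and any other choice made in [phi_inv] has the same
    corestriction. *)
Lemma phi_inv_gcomm (d : 'I_(a + b).+1 -> deg n.+1) (v : 'I_(a + b).+1 -> V) :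
  homw G d v -> let s := rev (word (down_letters d v) [set: 'I_(a + b).+1]%SET) in
  phi_inv G (A + B) (a := (a + b)%N) C v = bracket_coef s *: projW (C (rtens s)).
Proof.
have [[lC wC _] C0] := gcomm_CoDer; have lp := @projW_linear K V.
have [||L lL LE] := @TW_lift_homog K n.+1 V G' V (fun s =>
  bracket_coef s *: projW (C (rtens s))).
- apply: letter_linear_scale => [s t st|s t i c x y];
  first by rewrite /bracket_coef (up_exp_unzip1 st).
  by rewrite rtens_letter_linear lC lp.
- by rewrite rtens0 (lin0 lC) (lin0 lp) scaler0.
pose h : mmap V (a + b)%N := fun w => L (tens (word w [set: 'I_(a + b).+1]%SET)).
have hE (d' : 'I_(a + b).+1 -> deg n.+1) w : homw G' d' w ->
    let s := rev (word (letters d' w) [set: 'I_(a + b).+1]%SET) in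
    h w = bracket_coef s *: projW (C (rtens s)).
  move=> hw s; rewrite -LE; last by apply: homog_word_rev; exact: homog_word_letters.
  by rewrite /s rtens_letters.
have hM : Mspace G (A + B) h.
  split=> [w i c x y|d' w hw].
    have [s [t E]] := word_upd w i.
    by rewrite /h !E tens_multilinear lL.
  rewrite (hE (fun i => d' i - e)); last first.
    by move=> i; rewrite /homog /= /desusp_homog subrK; exact: hw.
  rewrite -[_ *: _]addr0; apply: homogZD; last exact: homog0.
  have := projW_homog (wC _ _ (rtens_thom (homog_word_down hw))).
  rewrite word_degree_rev (sumdeg_down d' w) cardsT card_ord /homog /= /desusp_homog.
  congr homog; rewrite /phi_weight mulrSr !addrA; congr (_ + _).
  by rewrite [RHS]addrAC [RHS]addrC -!addrA; congr (_ + _); rewrite addrCA.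
have phih : phi G (A + B) h = C.
  apply: funext; apply: (CoDer_eq (phiP hM).1 gcomm_CoDer) => d' w hw.
  have hs : homog_word G' (rev (word (letters d' w) [set: 'I_(a + b).+1]%SET)).
    by apply: homog_word_rev; exact: homog_word_letters.
  rewrite !(corestr_letters _ d') (projW_phi hM hs) phi_value_letters.
  rewrite (hE _ _ hw) (up_sign_letters _ w) !scalerA /bracket_coef.
  by rewrite [_ * (_ * _)]mulrA bracket_coef_sq scale1r.
move=> hv s; have hs := homog_word_down hv.
have [iM phiE] : Mspace G (A + B) (phi_inv G (A + B) (a := (a + b)%N) C) /\
    phi G (A + B) (phi_inv G (A + B) (a := (a + b)%N) C) = C.
  apply: (@xgetPex _ (fun=> 0) [set h | Mspace G (A + B) h /\ phi G (A + B) h =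
    C]%classic).
  by exists h.
rewrite -{2}phiE (projW_phi iM hs) /s phi_value_letters (up_sign_letters _ v).
by rewrite !scalerA -mulrA bracket_coef_sq scale1r.
Qed.
End Bracket.

Lemma pairing_bideg (A B : deg n.+1) a b :
  pairing (bideg A a) (bideg B b) = pairing A B + (a * b)%N%:Z.
Proof.
rewrite /pairing big_split_ord big_ord1; congr (_ + _).
  by apply: eq_bigr => i _; rewrite !row_mxEl.
by rewrite !row_mxEr !mxE eqxx.
Qed.
End Stem.

Theorem theorem3 (K : fieldType) (char0 : [pchar K] =i pred0)
    (n : nat) (V : lmodType K) (G : grading n.+1 V)
    (A B : deg n.+1) (a b : nat) (f : mmap V a) (g : mmap V b)
    (hf : Mspace G A f) (hg : Mspace G B g)
    (d : 'I_(a + b)%N.+1 -> deg n.+1) (v : 'I_(a + b)%N.+1 -> V)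
    (hv : homw G d v) :
  stem_bracket G A f B g v =
    jmap g B f A d v
    - sg K (pairing (bideg A a) (bideg B b)) *: jmap f A g B d v.
Proof.
have lp := @projW_linear K V.
set s := rev (word (down_letters d v) [set: 'I_(a + b).+1]%SET).
have E1 : bracket_coef a b s *: projW (phi G A f (phi G B g (rtens s))) =
    sg K (a%:Z * pairing (e1 n) B + pairing A B) *: jmap f A g B d v.
  by have := projW_phi_phi_jmap hf hg erefl hv.
have E2 : bracket_coef a b s *: projW (phi G B g (phi G A f (rtens s))) =
    sg K (b%:Z * pairing (e1 n) A + pairing B A) *: jmap g B f A d v.
  have ab : (a + b).+1 = (b + a).+1 by rewrite addnC.
  by have := projW_phi_phi_jmap hg hf ab hv; rewrite /= [(b + a)%N]addnC.
rewrite /stem_bracket [phi_inv _ _ _ _](phi_inv_gcomm hf hg hv) -/s /gcomm (linB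
  lp) (linZ lp).
move: (bracket_coef a b s) E1 E2 => c E1 E2.
rewrite [c *: _]scalerBr [c *: (_ *: _)]scalerA [c * _]mulrC -scalerA E1 E2.
have P1 : pairing (e1 n *+ a) (e1 n *+ b + B) =
    a%:Z * b%:Z + a%:Z * pairing (e1 n) B.
  rewrite pairingC pairing_muln pairingC pairingDr pairing_muln pairing_e1.
  by rewrite mulr1 mulrDr.
have P2 : pairing (phi_weight A a) (phi_weight B b) = pairing A B
    + b%:Z * pairing (e1 n) A + a%:Z * pairing (e1 n) B + a%:Z * b%:Z.
  rewrite /phi_weight pairingDr pairing_muln [pairing (_ + _) B]pairingC.
  rewrite [pairing (_ + _) (e1 n)]pairingC !pairingDr !pairing_muln pairing_e1.
  by rewrite (pairingC B A) (pairingC B (e1 n)); ring.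
(* What is left is to compare the signs in front of the two sums. *)
move: (jmap f A g B d v) (jmap g B f A d v) => J1 J2.
rewrite P1 P2 pairing_bideg (pairingC B A) PoszM scalerBr !scalerA -!sgD addrC.
have sg1 : -1 = sg K 1 by [].
congr (_ + _); last first.
  rewrite -scaleNr -mulN1r sg1 -sgD; congr (_ *: _); apply: eq_sg.
  by exists (a%:Z * pairing (e1 n) B); ring.
rewrite -scaleNr -[RHS]scale1r -mulN1r sg1 -sgD -[in RHS](sg0 K); congr (_ *: _).
apply: eq_sg.
exists (1 + a%:Z * b%:Z + a%:Z * pairing (e1 n) B + pairing A B
  + b%:Z * pairing (e1 n) A); ring.
Qed.
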